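(* Let $\nu$ be a probability measure on $\mathbb R^d$ with $R:=\operatorname{diam}(\operatorname{supp}(\nu))<\infty$, and let $p:=\gamma_d\star\nu$ be the convolution of the standard Gaussian measure $\gamma_d$ on $\mathbb R^d$ with $\nu$. Then the Brownian transport map $X_1$ between the Wiener measure $\gamma$ and $p$ is an almost-sure contraction with constant $\left(e^{\frac12R^2}-1\right)^{1/2}\frac{\sqrt2}{R}$.
   Context: Wiener space: $\Omega=C_0([0,1];\mathbb R^d)$ is the space of continuous paths $\omega:[0,1]\to\mathbb R^d$ with $\omega_0=0$, and $\gamma$ is the Wiener measure, so that $B_t(\omega)=\omega_t$ is a standard Brownian motion under $\gamma$. The Cameron–Martin space is $H^1=\{h: h_t=\int_0^t\dot h_s\,ds,\ \dot h\in L^2([0,1],\mathbb R^d)\}$ with $|h|_{H^1}^2=\int_0^1|\dot h_s|^2ds$. Brownian transport map: let $f=\frac{dp}{d\gamma_d}$ and let $P_t\eta(x)=\int\eta(x+\sqrt t z)\,d\gamma_d(z)$ be the heat semigroup. The Föllmer process $(X_t)_{t\in[0,1]}$ is the strong solution on $\Omega$ of $dX_t=\nabla\log P_{1-t}f(X_t)\,dt+dB_t$, $X_0=0$; it satisfies $X_1\sim p$. The Brownian transport map is $X_1:\Omega\to\mathbb R^d$. Almost-sure contraction: a measurable map $T:\Omega\to\mathbb R^d$ is an almost-sure contraction with constant $C$ if for $\gamma$-a.e. $\omega$, $|T(\omega+h)-T(\omega)|\le C|h|_{H^1}$ for all $h\in H^1$. Since $X_1$ is determined only up to $\gamma$-null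 sets, the property is understood for a suitable version of $X_1$. Convention: when $R=0$ the constant is read as its limit as $R\downarrow0$, namely $1$. *)

(* Defs.v *)
From HB Require Import structures.
From mathcomp Require Import all_boot all_order all_algebra.
From mathcomp Require Import all_classical all_reals all_analysis.
From mathcomp Require Import measurable_realfun.

Set Implicit Arguments.
Unset Strict Implicit.
Unset Printing Implicit Defensive.

Import Order.TTheory GRing.Theory Num.Theory.
Import numFieldNormedType.Exports.

Local Open Scope classical_set_scope.
Local Open Scope ring_scope.

Definition mx_borel_display : measure_display.
Proof. exact: default_measure_display. Qed.

Section mx_borel.
Context {R : realType} {m n : nat}.

Let mx_borel : set (set 'M[R]_(m, n)) := <<s @open 'M[R]_(m, n) >>.

Let mx_borel0 : mx_borel set0.
Proof. exact: sigma_algebra0. Qed.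

Let mx_borelC A : mx_borel A -> mx_borel (~` A).
Proof. exact: sigma_algebraC. Qed.

Let mx_borel_bigcup (F : (set 'M[R]_(m, n))^nat) :
  (forall i, mx_borel (F i)) -> mx_borel (\bigcup_i F i).
Proof. exact: sigma_algebra_bigcup. Qed.

HB.instance Definition _ := @isMeasurable.Build mx_borel_display
  'M[R]_(m, n) mx_borel mx_borel0 mx_borelC mx_borel_bigcup.

End mx_borel.

Section measurable_mx.
Context {R : realType}.

Lemma open_measurable_mx m n (A : set 'M[R]_(m, n)) : open A -> measurable A.
Proof. by move=> oA; exact: sub_sigma_algebra. Qed.

Lemma measurable_coord m n (i : 'I_m) (j : 'I_n) :
  measurable_fun setT (fun M : 'M[R]_(m, n) => M i j).
Proof.
apply: (measurability _ (RGenOpens.measurableE R)).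
move=> _ [_ [a [b ->]] <-]; rewrite setTI; apply: open_measurable_mx.
have /continuousP : continuous (fun M : 'M[R]_(m, n) => M i j).
  exact: coord_continuous.
by apply; exact: interval_open.
Qed.

Let rat_mx m n (q : 'M[rat]_(m, n)) : 'M[R]_(m, n) := map_mx ratr q.

Lemma open_bigcup_ball m n (U : set 'M[R]_(m, n)) : open U ->
  U = \bigcup_(p : 'M[rat]_(m, n) * nat)
        (if `[< ball (rat_mx p.1) p.2.+1%:R^-1 `<=` U >]
         then ball (rat_mx p.1) p.2.+1%:R^-1 else set0).
Proof.
move=> oU; apply/seteqP; split => [x Ux|x [p _]]; last first.
  by case: asboolP => // pU /pU.
have /nbhs_ballP[e /= e0 eU] : nbhs x U by exact: open_nbhs_nbhs.
pose k := Num.truncn (2 / e).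
have k0 : 0 < k.+1%:R^-1 :> R by rewrite invr_gt0 ltr0n.
have ke : k.+1%:R^-1 + k.+1%:R^-1 < e.
  have : 2 / e < k.+1%:R by exact: truncnS_gt.
  rewrite ltr_pdivrMr// mulrC -ltr_pdivrMr ?ltr0n//.
  by rewrite -[2]/(1 + 1) mulrDl mul1r.
have Q i j : exists q : rat, ball (x i j) k.+1%:R^-1 (ratr q : R).
  have [q] := @rat_in_itvoo R (x i j - k.+1%:R^-1) (x i j + k.+1%:R^-1)
    ltac:(by rewrite ltrD2l gt0_cp).
  rewrite in_itv/= => /andP[q1 q2]; exists q.
  by rewrite /ball/= ltr_distlC q1.
have Q' (ij : 'I_m * 'I_n) := Q ij.1 ij.2.
have [q xq] := choice Q'.
exists (\matrix_(i, j) q (i, j), k) => //=.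
case: asboolP => [_|[]].
  by split => // i j; rewrite !mxE; apply/ball_sym; exact: (xq (i, j)).
move=> y qy; apply: eU; apply: (@le_ball _ _ _ _ _ (ltW ke)).
apply: (ball_triangle _ qy).
by split => // i j; rewrite !mxE; exact: (xq (i, j)).
Qed.

Lemma measurable_fun_mx d (T : measurableType d) m n (f : T -> 'M[R]_(m, n)) :
  (forall i j, measurable_fun setT (fun x => f x i j)) ->
  measurable_fun setT f.
Proof.
move=> mf; apply: (measurability (@open 'M[R]_(m, n))) => //.
move=> _ [U oU <-]; rewrite setTI (open_bigcup_ball oU) preimage_bigcup.
apply: countable_bigcupT_measurable => [|p]; first exact: countableP.
case: asboolP => _; last by rewrite preimage_set0.
set c := rat_mx _; set r := _^-1.
have r0 : 0 < r by rewrite invr_gt0 ltr0n.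
rewrite (_ : _ @^-1` _ = \bigcap_(i in [set: 'I_m]) \bigcap_(j in [set: 'I_n])
  ((fun x => f x i j) @^-1` ball (c i j) r)); last first.
  apply/seteqP; split => [x [_ H] i _ j _|x H]; first exact: H.
  by split => // i j; exact: H.
apply: fin_bigcap_measurable => // i _; apply: fin_bigcap_measurable => // j _.
rewrite -[X in measurable X]setTI; apply: mf => //.
by apply: open_measurable; exact: ball_open.
Qed.

End measurable_mx.

Section euclidean_space.
Context {R : realType} {d : nat}.
Implicit Types (x y : 'rV[R]_d) (A : set 'rV[R]_d).

(* The norm `|x| of the library on row vectors is the sup norm. *)
Definition enorm x : R := Num.sqrt (\sum_(i < d) x ord0 i ^+ 2).

Definition diam A : \bar R :=
  ereal_sup [set (enorm (xy.1 - xy.2))%:E | xy in A `*` A].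

Definition supp (nu : set 'rV[R]_d -> \bar R) : set 'rV[R]_d :=
  [set x | forall U, open U -> U x -> (0 < nu U)%E].

Definition grad (u : 'rV[R]_d -> R) x : 'rV[R]_d :=
  \row_i 'D_(delta_mx ord0 i) u x.

(* Coordinatewise integral over [0, t]. *)
Definition vint (t : R) (g : R -> 'rV[R]_d) : 'rV[R]_d :=
  \row_i \int[lebesgue_measure]_(s in `[0, t]) g s ord0 i.

End euclidean_space.

Section gaussian.
Context {R : realType}.

(* (x, y) |-> (x, y_1, ..., y_d) *)
Definition row_cons (d : nat) (x : measurableTypeR R * 'rV[R]_d) : 'rV[R]_d.+1 :=
  \row_j oapp (x.2 ord0) x.1 (unlift ord0 j).

Lemma measurable_row_cons d : measurable_fun setT (@row_cons d).
Proof.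
apply: measurable_fun_mx => i j; under eq_fun do rewrite mxE.
case: (unlift ord0 j) => [k|] /=; last exact: measurable_fst.
exact: (measurableT_comp (measurable_coord _ _) measurable_snd).
Qed.

HB.instance Definition _ d :=
  isMeasurableFun.Build _ _ _ _ (@row_cons d) (@measurable_row_cons d).

(* N(0, I_d), as the d-fold product of N(0, 1). *)
Fixpoint gaussian (d : nat) : probability 'rV[R]_d R :=
  if d is d'.+1 then distribution (normal_prob 0 1 \x gaussian d')%E (@row_cons d')
  else dirac (0 : 'rV[R]_0).

Definition vadd d (x : 'rV[R]_d * 'rV[R]_d) := x.1 + x.2.

Lemma measurable_vadd d : measurable_fun setT (@vadd d).
Proof.
apply: measurable_fun_mx => i j; rewrite /vadd.
under eq_fun do rewrite mxE.
apply: measurable_funD.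
- exact: (measurableT_comp (measurable_coord _ _) measurable_fst).
- exact: (measurableT_comp (measurable_coord _ _) measurable_snd).
Qed.

HB.instance Definition _ d :=
  isMeasurableFun.Build _ _ _ _ (@vadd d) (@measurable_vadd d).

Definition convolution d (mu nu : probability 'rV[R]_d R)
  : probability 'rV[R]_d R := distribution (mu \x nu)%E (@vadd d).

(* f is a version of the Radon-Nikodym derivative dp/dmu. *)
Definition is_density d (p mu : probability 'rV[R]_d R) (f : 'rV[R]_d -> R) :=
  [/\ measurable_fun setT f, (forall x, 0 <= f x)
    & forall A, measurable A -> p A = (\int[mu]_(x in A) (f x)%:E)%E].

Definition heat d (t : R) (eta : 'rV[R]_d -> R) (x : 'rV[R]_d) : R :=
  \int[gaussian d]_z eta (x + Num.sqrt t *: z).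

End gaussian.

(* A continuous path on [0, 1] issued from 0 is represented by its extension
   by 0 to the whole line, so that equality is equality of paths on [0, 1]. *)
Record wiener_space (R : realType) (d : nat) := WienerPath {
  wpath :> R -> 'rV[R]_d ;
  wpath_continuous : {within `[0, 1], continuous wpath} ;
  wpath0 : wpath 0 = 0 ;
  wpath_out : forall t : R, t \notin `[0, 1] -> wpath t = 0 }.

Definition wiener_display : measure_display.
Proof. exact: default_measure_display. Qed.

Section wiener_space.
Context {R : realType} {d : nat}.
Local Notation Omega := (wiener_space R d).

Let zero_continuous : {within `[0, 1], continuous (fun _ : R => 0 : 'rV[R]_d)}.
Proof. by move=> x; exact: cvg_cst. Qed.

Definition wiener_zero : Omega :=
  WienerPath zero_continuous erefl (fun _ _ => erefl).

Section add.
Variables w h : Omega.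

Let add_continuous : {within `[0, 1], continuous (fun t => w t + h t)}.
Proof. by move=> x; apply: cvgD; exact: wpath_continuous. Qed.

Let add0 : w 0 + h 0 = 0.
Proof. by rewrite !wpath0 addr0. Qed.

Let add_out t : t \notin `[0, 1] -> w t + h t = 0.
Proof. by move=> t01; rewrite !wpath_out// addr0. Qed.

Definition wiener_add : Omega := WienerPath add_continuous add0 add_out.

End add.

HB.instance Definition _ := gen_eqMixin Omega.
HB.instance Definition _ := gen_choiceMixin Omega.
HB.instance Definition _ := isPointed.Build Omega wiener_zero.

Definition cylinder (t : R) : set (set Omega) :=
  [set A | exists (s : R) (B : set 'rV[R]_d),
    [/\ s \in `[0, t], measurable B & A = (fun w : Omega => w s) @^-1` B]].

Definition brownian_filtration (t : R) : set (set Omega) := <<s cylinder t >>.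

Let wiener0 : brownian_filtration 1 set0.
Proof. exact: sigma_algebra0. Qed.

Let wienerC A : brownian_filtration 1 A -> brownian_filtration 1 (~` A).
Proof. exact: sigma_algebraC. Qed.

Let wiener_bigcup (F : (set Omega)^nat) :
  (forall i, brownian_filtration 1 (F i)) ->
  brownian_filtration 1 (\bigcup_i F i).
Proof. exact: sigma_algebra_bigcup. Qed.

HB.instance Definition _ := @isMeasurable.Build wiener_display Omega
  (brownian_filtration 1) wiener0 wienerC wiener_bigcup.

End wiener_space.

Section brownian_transport_map.
Context {R : realType} {d : nat}.
Local Notation Omega := (wiener_space R d).

(* Under gamma the increments of the coordinate process over disjoint
   intervals [s, t] are independent with law N(0, (t - s) I_d). *)
Definition wiener_measure (gamma : probability Omega R) : Prop :=
  forall (n : nat) (t : nat -> R) (A : nat -> set 'rV[R]_d),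
    0 <= t 0%N -> t n <= 1 ->
    (forall k, (k < n)%N -> t k <= t k.+1) ->
    (forall k, measurable (A k)) ->
    gamma [set w : Omega | forall k, (k < n)%N -> A k (w (t k.+1) - w (t k))] =
    (\prod_(k < n)
      gaussian d [set z | A k (Num.sqrt (t k.+1 - t k) *: z)])%E.

Definition is_cm_derivative (h : Omega) (g : R -> 'rV[R]_d) : Prop :=
  [/\ measurable_fun `[(0 : R), 1] g,
      (\int[lebesgue_measure]_(s in `[(0 : R)%R, 1%R])
        ((enorm (g s) ^+ 2)%:E) < +oo)%E
    & forall t : R, t \in `[0, 1] -> h t = vint t g].

Definition cameron_martin : set Omega :=
  [set h | exists g, is_cm_derivative h g].

(* The derivative is unique up to Lebesgue-null sets: the norm does not
   depend on the chosen version. *)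
Definition cm_derivative (h : Omega) : R -> 'rV[R]_d :=
  xget (fun=> 0) (is_cm_derivative h).

Definition cm_norm (h : Omega) : R :=
  Num.sqrt (\int[lebesgue_measure]_(s in `[0, 1])
    (enorm (cm_derivative h s) ^+ 2)).

Definition almost_sure_contraction (gamma : probability Omega R)
    (T : Omega -> 'rV[R]_d) (C : R) : Prop :=
  {ae gamma, forall w, forall h, cameron_martin h ->
    enorm (T (wiener_add w h) - T w) <= C * cm_norm h}.

Definition follmer_drift (f : 'rV[R]_d -> R) (t : R) (x : 'rV[R]_d) :=
  grad (fun y => ln (heat (1 - t) f y)) x.

(* Strong solution of dX_t = follmer_drift f t X_t dt + dB_t, X_0 = 0:
   adapted to the gamma-augmented filtration of B and satisfying the
   integrated equation almost surely. The noise being additive, no stochastic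
   integral is involved. *)
Definition follmer_process (gamma : probability Omega R)
    (f : 'rV[R]_d -> R) (X : R -> Omega -> 'rV[R]_d) : Prop :=
  (forall (t : R) (B : set 'rV[R]_d), t \in `[0, 1] -> measurable B ->
    exists2 E, brownian_filtration t E & gamma.-negligible ((X t @^-1` B) `+` E))
  /\
  {ae gamma, forall w,
    [/\ {within `[0, 1], continuous (X ^~ w)},
        (forall i, lebesgue_measure.-integrable `[0, 1]
           (fun s => (follmer_drift f s (X s w) ord0 i)%:E))
      & forall t : R, t \in `[0, 1] ->
          X t w = vint t (fun s => follmer_drift f s (X s w)) + w t]}.

End brownian_transport_map.

(* The value at r = 0 is the limit as r tends to 0. *)
Definition contraction_constant {R : realType} (r : R) : R :=
  if r == 0 then 1
  else Num.sqrt (expR (r ^+ 2 / 2) - 1) * (Num.sqrt 2 / r).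

(* Main.v *)
Require Import Defs.
From HB Require Import structures.
From mathcomp Require Import all_boot all_order all_algebra.
From mathcomp Require Import all_classical all_reals all_analysis.
From mathcomp Require Import measurable_realfun ring lra.

Import Order.TTheory GRing.Theory Num.Theory.
Import numFieldNormedType.Exports.
Local Open Scope classical_set_scope.
Local Open Scope ring_scope.
Set Implicit Arguments.
Unset Strict Implicit.
Unset Printing Implicit Defensive.

(** By the Cameron-Martin formula, the density of [gamma_d * nu] with respect to
    the Gaussian measure [gamma_d] is the mixture [f x = \int exp (<x, y> -
    |y|^2 / 2) nu(dy)]. Integrating out a Gaussian variable, which only involves
    its moment generating function, yields [P_(1-t) f x = \int exp (<x, y> - t
    |y|^2 / 2) nu(dy)] for [t < 1] ([heat_density]). Hence the drift [grad (log
    P_(1-t) f)] at [x] is the mean of the exponential tilt of [nu] with density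
    proportional to [exp (<x, y> - t |y|^2 / 2)] ([follmer_driftE]), and the
    Jacobian of the drift is the covariance matrix of this tilt. A measure
    carried by a set of diameter [R] has variance at most [R^2 / 4] in every
    direction, so the drift is Lipschitz in space with constant [L = R^2 / 4],
    uniformly in time ([posterior_mean_lipschitz]).

    The noise being additive, the equation [X_t = \int_0^t drift (s, X_s) ds +
    w_t] makes sense for each continuous path [w] separately and is solved by
    Picard iteration ([picard_lim_solution]). The iterates at time [t] are
    measurable functions of the restriction of [w] to [[0, t]], hence so is
    their limit ([measurable_picard_lim]): this is a Follmer process defined for
    every [w].

    Let [D] be the difference of the solutions driven by [w + h] and by [w]. The
    Lipschitz bound gives [|D_t| <= \int_0^t (L |D_s| + |h'_s|) ds], and
    Gronwall's inequality [|D_1| <= \int_0^1 exp (L (1 - s)) |h'_s| ds]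
    ([integrable_gronwall]). By the Cauchy-Schwarz inequality this is at most
    the Cameron-Martin norm of [h] times the square root of [\int_0^1 exp (2 L
    (1 - s)) ds = (exp (R^2 / 2) - 1) (2 / R^2)], which is the square of the
    announced constant ([contraction_constant_weight]). The case [h = 0] is
    pathwise uniqueness: any Follmer process agrees almost surely at time 1 with
    the pathwise solution, which is the required version. *)

(** * Gaussian integrals *)

Section density.
Import HBNNSimple.
Context d (T : measurableType d) (R : realType).
Variables (m n : {measure set T -> \bar R}) (w : T -> R).
Hypotheses (mw : measurable_fun setT w) (w0 : forall x, 0 <= w x).
Hypothesis nE : forall A, measurable A -> n A = (\int[m]_(x in A) (w x)%:E)%E.

Let integral_density_nnsfun (h : {nnsfun T >-> R}) :
  (\int[n]_x (h x)%:E = \int[m]_x ((h x)%:E * (w x)%:E))%E.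
Proof.
under [LHS]eq_integral do rewrite fimfunE -fsumEFin//.
rewrite [LHS]ge0_integral_fsum//; last 2 first.
  - by move=> r; exact/measurable_EFinP/measurableT_comp.
  - by move=> r x _; rewrite EFinM nnfun_muleindic_ge0.
under [RHS]eq_integral => x _.
  rewrite fimfunE -fsumEFin// ge0_mule_fsuml; last first.
    by move=> r; rewrite EFinM nnfun_muleindic_ge0.
  over.
rewrite [RHS]ge0_integral_fsum//; last 2 first.
  - move=> r; apply: emeasurable_funM; last exact/measurable_EFinP.
    exact/measurable_EFinP/measurableT_comp.
  - move=> r x _; rewrite mule_ge0 ?lee_fin//.
    by rewrite -lee_fin EFinM nnfun_muleindic_ge0.
apply: eq_fsbigr => r _.
rewrite integralZl_indic_nnsfun// integral_indic// setIT nE//.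
have [r0|r0] := leP 0 r; last first.
  rewrite preimage_nnfun0// integral_set0 mule0.
  by under eq_integral do rewrite indicE in_set0 mulr0 mul0e;
    rewrite integral0_eq.
under [RHS]eq_integral do rewrite EFinM -muleA.
rewrite ge0_integralZl//; last 2 first.
  - apply: emeasurable_funM; last exact/measurable_EFinP.
    exact/measurable_EFinP.
  - by move=> x _; rewrite mule_ge0// lee_fin.
congr (_ * _)%E; rewrite integral_mkcond; apply: eq_integral => x _.
by rewrite patchE indicE; case: ifP; rewrite ?mul1e ?mul0e.
Qed.

Lemma ge0_integral_density (g : T -> \bar R) :
  measurable_fun setT g -> (forall x, 0 <= g x)%E ->
  (\int[n]_x g x = \int[m]_x (g x * (w x)%:E))%E.
Proof.
move=> mg g0; pose h := nnsfun_approx measurableT mg.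
have hg x : ((h k x)%:E @[k --> \oo] --> g x)%E.
  exact: cvg_nnsfun_approx.
transitivity (limn (fun k => \int[n]_x (h k x)%:E))%E.
  rewrite -monotone_convergence//=.
  - by apply: eq_integral => x _; apply/esym/cvg_lim.
  - by move=> k; exact/measurable_EFinP.
  - by move=> k x _; rewrite lee_fin.
  - by move=> x _ j k jk; rewrite lee_fin; exact/lefP/nd_nnsfun_approx.
under eq_fun do rewrite integral_density_nnsfun.
rewrite -monotone_convergence//=.
- apply: eq_integral => x _; apply/cvg_lim => //.
  exact: cvgeMr.
- move=> k; apply: emeasurable_funM; exact/measurable_EFinP.
- by move=> k x _; rewrite mule_ge0// lee_fin.
- move=> x _ j k jk; rewrite lee_wpmul2r ?lee_fin//.
  exact/lefP/nd_nnsfun_approx.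
Qed.

End density.

Section lebesgue_affine.
Context {R : realType}.
Notation mu := (@lebesgue_measure R).

Let aff (a s z : R) : measurableTypeR R := a + s * z.

Let maff a s : measurable_fun setT (aff a s).
Proof.
apply: continuous_measurable_fun => x; apply: cvgD; first exact: cvg_cst.
by apply: cvgM; [exact: cvg_cst|exact: cvg_id].
Qed.

Lemma lebesgue_measure_affine (a s : R) (s0 : 0 < s) (A : set R) :
  measurable A ->
  mu A = pushforward (mscale (NngNum (ltW s0)) mu) (aff a s) A.
Proof.
move=> mA; apply: lebesgue_measure_unique => [|Hm _ [[x y]] _ <-|//].
  exact: maff.
rewrite /= /pushforward /mscale /=.
have -> : aff a s @^-1` `]x, y] = `](x - a) / s, (y - a) / s]%classic.
  apply/seteqP; split => z /=; rewrite /aff !in_itv/= ltr_pdivrMr//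
    ler_pdivlMr//;
    by rewrite ltrBlDl lerBrDl mulrC.
rewrite !lebesgue_measure_itv/= !lte_fin ltr_pM2r ?invr_gt0// ltrD2r.
case: ifPn => _; last by rewrite mule0.
rewrite -!EFinD -EFinM; congr EFin; field; exact: lt0r_neq0.
Qed.

Lemma ge0_integral_affine (a s : R) (g : R -> \bar R) : 0 < s ->
  measurable_fun setT g -> (forall x, 0 <= g x)%E ->
  (\int[mu]_x g x = s%:E * \int[mu]_z g (a + s * z)%R)%E.
Proof.
move=> s0 mg g0; have mgs : measurable_fun setT (g \o aff a s).
  by apply: (measurableT_comp mg); exact: maff.
transitivity (\int[mscale (NngNum (ltW s0)) mu]_z (g \o aff a s) z)%E.
  rewrite -[in RHS](preimage_setT (aff a s)) -ge0_integral_pushforward//.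
  apply: eq_measure_integral => [|Hm A mA _ /=]; first exact: maff.
  exact: lebesgue_measure_affine.
  exact: maff.
have := @ge0_integral_mscale _ _ _ mu setT measurableT (NngNum (ltW s0)) _ mgs.
by apply => x _; exact: g0.
Qed.
End lebesgue_affine.

(** The density of N(a, s^2) with respect to N(0, 1). *)
Definition affine_density {R : realType} (a s u : R) : R :=
  s^-1 * expR (u ^+ 2 / 2 - (u - a) ^+ 2 / (2 * s ^+ 2)).

Section normal_affine.
Context {R : realType}.
Notation mu := (@lebesgue_measure R).
Implicit Types a s u : R.

Lemma affine_density_ge0 a s u : 0 < s -> 0 <= affine_density a s u.
Proof. by move=> s0; rewrite mulr_ge0 ?expR_ge0// invr_ge0 ltW. Qed.

Lemma measurable_affine_density a s : measurable_fun setT (affine_density a s).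
Proof.
apply: measurable_funM => //; apply: measurableT_comp => //.
apply: measurable_funB; apply: measurable_funM => //.
by apply: measurable_funX; exact: measurable_funB.
Qed.

Lemma integral_normal_affine a s (g : R -> \bar R) : 0 < s ->
  measurable_fun setT g -> (forall x, 0 <= g x)%E ->
  (\int[normal_prob 0 1]_z g (a + s * z)%R =
   \int[normal_prob 0 1]_z (g z * (affine_density a s z)%:E))%E.
Proof.
move=> s0 mg g0.
have mpdf : measurable_fun setT (@normal_pdf R 0 1).
  exact: measurable_normal_pdf.
have pdf0 x : 0 <= @normal_pdf R 0 1 x by exact: normal_pdf_ge0.
have sn0 : s != 0 by exact: lt0r_neq0.
have dE h : measurable_fun setT h -> (forall x, 0 <= h x)%E ->
  (\int[@normal_prob R 0 1]_x h x =
   \int[mu]_x (h x * (normal_pdf 0 1 x)%:E))%E.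
  move=> mh h0.
  have := @ge0_integral_density _ _ R mu (@normal_prob R 0 1) _ mpdf pdf0.
  by apply.
have maff (b t : R) : measurable_fun setT (fun z => b + t * z).
  apply: measurable_funD => //; exact: measurable_funM.
rewrite dE//; last by apply: (measurableT_comp mg); exact: maff.
rewrite dE; last 2 first.
  - apply: emeasurable_funM => //; apply/measurable_EFinP.
    exact: measurable_affine_density.
  - by move=> x; rewrite mule_ge0// lee_fin affine_density_ge0.
pose G u := (g u * (affine_density a s u)%:E * (normal_pdf 0 1 u)%:E)%E.
have G0 u : (0 <= G u)%E.
  by rewrite mule_ge0 ?lee_fin// mule_ge0// lee_fin affine_density_ge0.
have mG : measurable_fun setT G.
  apply: emeasurable_funM; last exact/measurable_EFinP.
  apply: emeasurable_funM => //; apply/measurable_EFinP.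
  exact: measurable_affine_density.
rewrite (ge0_integral_affine a s0 mG G0) -ge0_integralZl//; last 2 first.
  - by apply: (measurableT_comp mG); exact: maff.
  - by rewrite lee_fin ltW.
apply: eq_integral => z _.
rewrite /G -[in RHS]muleA [RHS]muleCA; congr (_ * _)%E.
rewrite -!EFinM; congr EFin.
rewrite !normal_pdfE ?oner_neq0// /normal_fun /affine_density.
rewrite [RHS]mulrA [RHS]mulrCA; congr (_ * _).
rewrite mulrA mulfV// mul1r -expRD; congr expR; field; exact: sn0.
Qed.
End normal_affine.

Section gaussian_affine.
Context {R : realType}.

Lemma integral_gaussianS d (g : 'rV[R]_d.+1 -> \bar R) :
  measurable_fun setT g -> (forall x, 0 <= g x)%E ->
  (\int[gaussian d.+1]_z g z =
   \int[normal_prob 0 1]_a \int[gaussian d]_y g (row_cons (a, y)))%E.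
Proof.
move=> mg g0 /=; rewrite ge0_integral_distribution//.
have mgr := measurableT_comp mg (@measurable_row_cons R d).
rewrite (fubini_tonelli1 _ mgr) => [|x]; [by []|exact: g0].
Qed.

Lemma row_cons_affine d (x : 'rV[R]_d.+1) (s a : R) (y : 'rV[R]_d) :
  x + s *: row_cons (a, y) =
  row_cons (x ord0 ord0 + s * a, \row_i x ord0 (lift ord0 i) + s *: y).
Proof.
apply/rowP => j; rewrite !mxE.
by case: unliftP => [k ->|->] /=; rewrite ?mxE.
Qed.

Definition gaussian_affine_density d (x : 'rV[R]_d) (s : R) (z : 'rV[R]_d) : R
  :=
  \prod_(i < d) affine_density (x ord0 i) s (z ord0 i).

Lemma gaussian_affine_density_ge0 d (x : 'rV[R]_d) s z : 0 < s ->
  0 <= gaussian_affine_density x s z.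
Proof. by move=> s0; apply: prodr_ge0 => i _; exact: affine_density_ge0. Qed.

Lemma measurable_gaussian_affine_density d (x : 'rV[R]_d) s :
  measurable_fun setT (gaussian_affine_density x s).
Proof.
apply: measurable_prod => i _.
apply: (measurableT_comp (measurable_affine_density _ _)).
exact: measurable_coord.
Qed.

Lemma gaussian_affine_densityS d (x : 'rV[R]_d.+1) s a (y : 'rV[R]_d) :
  gaussian_affine_density x s (row_cons (a, y)) =
  affine_density (x ord0 ord0) s a *
  gaussian_affine_density (\row_i x ord0 (lift ord0 i)) s y.
Proof.
rewrite /gaussian_affine_density big_ord_recl !mxE unlift_none; congr (_ * _).
by apply: eq_bigr => i _; rewrite !mxE liftK.
Qed.

(** By induction on the dimension, with Tonelli's theorem. For [s = 1] this is
    the Cameron-Martin formula; for all [s > 0] it shows that affine maps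
    preserve Gaussian null sets, so that the heat flow of a density does not
    depend on the chosen version. *)
Lemma integral_gaussian_affine d (x : 'rV[R]_d) s (g : 'rV[R]_d -> \bar R) :
  0 < s -> measurable_fun setT g -> (forall z, 0 <= g z)%E ->
  (\int[gaussian d]_z g (x + s *: z)%R =
   \int[gaussian d]_z (g z * (gaussian_affine_density x s z)%:E))%E.
Proof.
move=> s0; elim: d x g => [x g mg g0|d IH x g mg g0].
  apply: eq_integral => z _; rewrite /gaussian_affine_density big_ord0 mule1.
  by congr g; apply/rowP => -[].
have maff n (u : 'rV[R]_n) : measurable_fun setT (fun z : 'rV[R]_n => u + s *:
  z).
  apply: measurable_fun_mx => i j; under eq_fun do rewrite !mxE.
  by apply: measurable_funD => //; apply: measurable_funM => //;
    exact: measurable_coord.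
have mr := @measurable_row_cons R d.
rewrite integral_gaussianS//; last by apply: (measurableT_comp mg); exact: maff.
rewrite integral_gaussianS//; last 2 first.
  - apply: emeasurable_funM => //; apply/measurable_EFinP.
    exact: measurable_gaussian_affine_density.
  - by move=> z; rewrite mule_ge0// lee_fin gaussian_affine_density_ge0.
set x' := (\row_i x ord0 (lift ord0 i)).
pose G (p : measurableTypeR R * 'rV[R]_d) : \bar R :=
  (g (row_cons p) * (gaussian_affine_density x' s p.2)%:E)%E.
have G0 p : (0 <= G p)%E.
  by rewrite mule_ge0// lee_fin gaussian_affine_density_ge0.
have mG : measurable_fun setT G.
  apply: emeasurable_funM; first exact: (measurableT_comp mg mr).
  apply/measurable_EFinP; apply: measurableT_comp => //.
  exact: measurable_gaussian_affine_density.
pose H a := (\int[gaussian d]_y G (a, y))%E.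
transitivity (\int[normal_prob 0 1]_a H (x ord0 ord0 + s * a)%R)%E.
  apply: eq_integral => a _.
  under eq_integral do rewrite row_cons_affine.
  rewrite (IH x' (fun y => g (row_cons (x ord0 ord0 + s * a, y))))//.
  exact: (measurableT_comp (measurableT_comp mg mr) (pair1_measurable _)).
have H0 a : (0 <= H a)%E by exact: integral_ge0.
have mH : measurable_fun setT H by exact: measurable_fun_fubini_tonelli_F.
rewrite integral_normal_affine//; apply: eq_integral => a _.
under [RHS]eq_integral do rewrite gaussian_affine_densityS.
rewrite muleC -ge0_integralZl//; last 2 first.
  - exact: (measurableT_comp mG (pair1_measurable _)).
  - by rewrite lee_fin affine_density_ge0.
by apply: eq_integral => y _; rewrite EFinM muleCA.
Qed.

End gaussian_affine.

(** * The heat flow of the density *)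

Definition dot {R : realType} {d : nat} (u v : 'rV[R]_d) : R :=
  \sum_(i < d) u ord0 i * v ord0 i.

Section dot.
Context {R : realType} {d : nat}.
Implicit Types u v w : 'rV[R]_d.

Lemma dotC u v : dot u v = dot v u.
Proof. by apply: eq_bigr => i _; rewrite mulrC. Qed.

Lemma dotDl u v w : dot (u + v) w = dot u w + dot v w.
Proof.
by rewrite -big_split; apply: eq_bigr => i _; rewrite mxE mulrDl.
Qed.

Lemma dotZl (a : R) u v : dot (a *: u) v = a * dot u v.
Proof. by rewrite mulr_sumr; apply: eq_bigr => i _; rewrite mxE mulrA. Qed.

Lemma dotNl u v : dot (- u) v = - dot u v.
Proof. by rewrite -scaleN1r dotZl mulN1r. Qed.

Lemma dotBl u v w : dot (u - v) w = dot u w - dot v w.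
Proof. by rewrite dotDl dotNl. Qed.

Lemma measurable_dotr u : measurable_fun setT (dot u).
Proof.
apply: measurable_sum => i; apply: measurable_funM => //.
exact: measurable_coord.
Qed.

Lemma measurable_dot2 :
  measurable_fun setT (fun p : 'rV[R]_d * 'rV[R]_d => dot p.1 p.2).
Proof.
apply: measurable_sum => i; apply: measurable_funM.
- exact: (measurableT_comp (measurable_coord _ _) measurable_fst).
- exact: (measurableT_comp (measurable_coord _ _) measurable_snd).
Qed.

Lemma measurable_dotrr : measurable_fun setT (fun u => dot u u).
Proof.
by apply: measurable_sum => i; apply: measurable_funM; exact: measurable_coord.
Qed.

End dot.

Section heat_density.
Context {R : realType} {d : nat}.
Notation gam := (gaussian (R := R) d).
Implicit Types x y z : 'rV[R]_d.

Lemma gaussian_affine_density1 y z :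
  gaussian_affine_density y 1 z = expR (dot z y - dot y y / 2).
Proof.
rewrite /gaussian_affine_density.
under eq_bigr => i _ do rewrite /affine_density invr1 mul1r.
rewrite -expR_sum; congr expR.
rewrite /dot mulr_suml -sumrB; apply: eq_bigr => i _.
by field.
Qed.

(** A translated Gaussian measure still has total mass 1. *)
Lemma gaussian_mgf y :
  (\int[gam]_z (expR (dot z y))%:E = (expR (dot y y / 2))%:E)%E.
Proof.
have := @integral_gaussian_affine R d y 1 (fun=> 1%E) ltr01
  (measurable_cst _) (fun=> lee01).
rewrite integral_cst// mul1e [X in X = _ -> _]probability_setT.
under eq_integral do rewrite mul1e gaussian_affine_density1 expRD EFinM muleC.
rewrite ge0_integralZl//; last first.
  apply/measurable_EFinP; apply: measurableT_comp => //.
  by under eq_fun do rewrite dotC; exact: measurable_dotr.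
move=> /(congr1 (fun u => (expR (dot y y / 2))%:E * u)%E).
by rewrite mule1 muleA -EFinM -expRD subrr expR0 mul1e => <-.
Qed.

Variables (nu : probability 'rV[R]_d R) (f : 'rV[R]_d -> R).
Hypothesis pf : is_density (convolution gam nu) gam f.

(** The Cameron-Martin density at [p.1] of the Gaussian measure translated by
    [p.2]. *)
Let k (p : 'rV[R]_d * 'rV[R]_d) : \bar R :=
  (expR (dot p.1 p.2 - dot p.2 p.2 / 2))%:E.

Let f0 x : \bar R := (\int[nu]_y k (x, y))%E.

Let k0 p : (0 <= k p)%E. Proof. by rewrite lee_fin expR_ge0. Qed.

Let mk : measurable_fun setT k.
Proof.
apply/measurable_EFinP; apply: measurableT_comp => //; apply: measurable_funB.
  exact: measurable_dot2.
apply: measurable_funM => //; exact: (measurableT_comp measurable_dotrr).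
Qed.

Let mf0 : measurable_fun setT f0.
Proof. exact: measurable_fun_fubini_tonelli_F. Qed.

Let f00 x : (0 <= f0 x)%E. Proof. exact: integral_ge0. Qed.

Let convolutionE (A : set 'rV[R]_d) : measurable A ->
  (convolution gam nu A = \int[gam]_(x in A) f0 x)%E.
Proof.
move=> mA; pose g z : \bar R := (\1_A z)%:E.
have g0 z : (0 <= g z)%E by rewrite lee_fin.
have mg : measurable_fun setT g by exact/measurable_EFinP/measurable_indic.
have mgv := measurableT_comp mg (@measurable_vadd R d).
rewrite -[A in LHS]setIT -integral_indic// ge0_integral_distribution//.
rewrite (fubini_tonelli2 _ mgv) => [|p]; last exact: g0.
rewrite /fubini_G.
transitivity (\int[nu]_y \int[gam]_x (g x * k (x, y)))%E.
  apply: eq_integral => y _.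
  transitivity (\int[gam]_x g (y + 1 *: x)%R)%E.
    by apply: eq_integral => x _; rewrite scale1r addrC.
  rewrite integral_gaussian_affine//; apply: eq_integral => x _.
  by rewrite gaussian_affine_density1.
rewrite -(fubini_tonelli (fun p => g p.1 * k p)%E); last 2 first.
- by apply: emeasurable_funM => //; apply: (measurableT_comp mg).
- by move=> p; rewrite mule_ge0.
rewrite [RHS]integral_mkcond; apply: eq_integral => x _.
transitivity (g x * f0 x)%E.
  rewrite /= /f0 -ge0_integralZl//.
  exact: (measurableT_comp mk (pair1_measurable _)).
by rewrite /g patchE indicE; case: ifP => _; rewrite ?mul1e ?mul0e.
Qed.

Let density_ae : ae_eq gam setT (EFin \o f) f0.
Proof.
have [mf ff pE] := pf.
apply: integral_ae_eq => //.
- apply/integrableP; split; first exact/measurable_EFinP.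
  under eq_integral => x _ do rewrite gee0_abs ?lee_fin//.
  by rewrite -pE// [X in (X < _)%E]probability_setT ltry.
- by move=> E _ mE; rewrite -pE// convolutionE.
Qed.

(** The affine density serves twice: it carries the almost sure equality of [f]
    with the mixture over to the point [x], then it is removed again before
    integrating each exponential, where the two quadratic exponents
    [s |y|^2 / 2] and [- |y|^2 / 2] add up. *)
Lemma heat_density s x : 0 < s ->
  heat s f x = \int[nu]_y expR (dot x y - (1 - s) * (dot y y / 2)).
Proof.
move=> s0; have [mf ff _] := pf; have ss0 : 0 < Num.sqrt s by rewrite sqrtr_gt0.
congr fine.
rewrite (@integral_gaussian_affine R d x (Num.sqrt s) (EFin \o f))//;
  last exact/measurable_EFinP.
transitivity (\int[gam]_z
    (f0 z * (gaussian_affine_density x (Num.sqrt s) z)%:E))%E.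
  have mr : measurable_fun setT
      (EFin \o gaussian_affine_density x (Num.sqrt s)).
    by apply/measurable_EFinP; exact: measurable_gaussian_affine_density.
  apply: ae_eq_integral => //.
  - by apply: emeasurable_funM => //; exact/measurable_EFinP.
  - exact: emeasurable_funM.
  - have := ae_eqe_mul2l (EFin \o gaussian_affine_density x (Num.sqrt s))
      density_ae.
    by apply: filterS => z /= h zT; rewrite muleC h// muleC.
rewrite -integral_gaussian_affine// /f0.
pose K (p : 'rV[R]_d * 'rV[R]_d) := k (x + Num.sqrt s *: p.1, p.2).
have mK : measurable_fun setT K.
  apply: (measurableT_comp mk).
  apply/prod_measurable_funP; split => /=; last exact: measurable_snd.
  apply: measurable_fun_mx => i j.
  under eq_fun do rewrite !mxE.
  apply: measurable_funD => //; apply: measurable_funM => //.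
  exact: (measurableT_comp (measurable_coord _ _) measurable_fst).
rewrite (fubini_tonelli K mK) => [|p]; last exact: k0.
apply: eq_integral => y _.
rewrite /K /k /=.
transitivity (\int[gam]_z ((expR (dot x y - dot y y / 2))%:E *
    (expR (dot z (Num.sqrt s *: y)))%:E))%E.
  apply: eq_integral => z _; rewrite -EFinM -expRD dotDl dotZl.
  rewrite [dot z (_ *: _)]dotC dotZl [dot y z]dotC; congr ((expR _)%:E); ring.
rewrite ge0_integralZl//; last first.
  apply/measurable_EFinP; apply: measurableT_comp => //.
  by under eq_fun do rewrite dotC; exact: measurable_dotr.
rewrite gaussian_mgf -EFinM -expRD; congr ((expR _)%:E).
rewrite dotZl [dot y (_ *: _)]dotC dotZl mulrA -expr2 sqr_sqrtr ?ltW//; ring.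
Qed.
End heat_density.

(** * Exponentially tilted means *)

Section tilt.
Context d (T : measurableType d) (R : realType).
Variables (nu : probability T R) (S : set T).
Hypotheses (mS : measurable S) (nuS : nu S = 1%E).
Implicit Types (a b phi psi : T -> R).

Definition bounded_mfun phi :=
  measurable_fun setT phi /\ exists M, forall y, S y -> `|phi y| <= M.

Lemma bounded_mfun_cst (c : R) : bounded_mfun (fun=> c).
Proof. by split => //; exists `|c|. Qed.

Lemma bounded_mfunD phi psi : bounded_mfun phi -> bounded_mfun psi ->
  bounded_mfun (fun y => phi y + psi y).
Proof.
move=> [m1 [M1 h1]] [m2 [M2 h2]]; split; first exact: measurable_funD.
by exists (M1 + M2) => y Sy; rewrite (le_trans (ler_normD _ _))// lerD// ?h1
  ?h2.
Qed.

Lemma bounded_mfunM phi psi : bounded_mfun phi -> bounded_mfun psi ->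
  bounded_mfun (fun y => phi y * psi y).
Proof.
move=> [m1 [M1 h1]] [m2 [M2 h2]]; split; first exact: measurable_funM.
by exists (M1 * M2) => y Sy; rewrite normrM ler_pM// ?h1 ?h2.
Qed.

Lemma bounded_mfun_exp phi : bounded_mfun phi ->
  bounded_mfun (fun y => expR (phi y)).
Proof.
move=> [m1 [M1 h1]]; split; first exact: measurableT_comp.
exists (expR M1) => y Sy; rewrite ger0_norm ?expR_ge0// ler_expR.
exact: le_trans (ler_norm _) (h1 _ Sy).
Qed.

Lemma bounded_mfun_integrable phi : bounded_mfun phi ->
  nu.-integrable S (EFin \o phi).
Proof.
move=> [m1 [M1 h1]]; apply: measurable_bounded_integrable => //.
- by rewrite [X in (X < _)%E]nuS ltry.
- exact: measurable_funTS.
- exists M1; split; first exact: num_real.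
  by move=> M M1M y Sy; exact: le_trans (h1 _ Sy) (ltW M1M).
Qed.

(** The tilt of [nu] by [a] is the probability measure on [S] whose density is
    proportional to [expR a]; it only enters through its means and covariances,
    [tilt_int] being the unnormalized mean. *)
Definition tilt_int a phi : R := \int[nu]_(y in S) (phi y * expR (a y)).
Definition tilt_mean a phi : R := tilt_int a phi / tilt_int a (fun=> 1).
Definition tilt_cov a phi psi : R :=
  tilt_mean a (fun y => phi y * psi y) - tilt_mean a phi * tilt_mean a psi.

Section basics.
Variable a : T -> R.
Hypothesis ba : bounded_mfun a.

Let be := bounded_mfun_exp ba.

Let int_tilt phi : bounded_mfun phi ->
  nu.-integrable S (EFin \o (fun y => phi y * expR (a y))).
Proof. by move=> bp; exact/bounded_mfun_integrable/bounded_mfunM. Qed.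

Lemma tilt_int1_gt0 : 0 < tilt_int a (fun=> 1).
Proof.
have [ma [M aM]] := ba.
apply: (@lt_le_trans _ _ (expR (- M))); first exact: expR_gt0.
rewrite -[leLHS]mulr1 -[X in _ * X](congr1 fine nuS).
rewrite -Rintegral_cst//; apply: le_Rintegral => //.
- exact/bounded_mfun_integrable/bounded_mfun_cst.
- exact/int_tilt/bounded_mfun_cst.
- move=> y Sy; rewrite mul1r ler_expR lerNl.
  by rewrite (le_trans _ (aM _ Sy))// -normrN ler_norm.
Qed.

Lemma tilt_intD phi psi : bounded_mfun phi -> bounded_mfun psi ->
  tilt_int a (fun y => phi y + psi y) = tilt_int a phi + tilt_int a psi.
Proof.
move=> b1 b2; rewrite /tilt_int -RintegralD; [|exact: mS|exact: int_tilt..].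
by apply: eq_Rintegral => y _; rewrite mulrDl.
Qed.

Lemma tilt_intZ (c : R) phi : bounded_mfun phi ->
  tilt_int a (fun y => c * phi y) = c * tilt_int a phi.
Proof.
move=> b1; rewrite /tilt_int -RintegralZl//; last exact: int_tilt.
by apply: eq_Rintegral => y _; rewrite mulrA.
Qed.

Lemma tilt_int_le phi psi : bounded_mfun phi -> bounded_mfun psi ->
  (forall y, S y -> phi y <= psi y) -> tilt_int a phi <= tilt_int a psi.
Proof.
move=> b1 b2 h; apply: le_Rintegral => //; [exact: int_tilt..|].
by move=> y Sy; rewrite ler_wpM2r ?expR_ge0// h.
Qed.

Lemma tilt_meanD phi psi : bounded_mfun phi -> bounded_mfun psi ->
  tilt_mean a (fun y => phi y + psi y) = tilt_mean a phi + tilt_mean a psi.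
Proof. by move=> b1 b2; rewrite /tilt_mean tilt_intD// mulrDl. Qed.

Lemma tilt_meanZ (c : R) phi : bounded_mfun phi ->
  tilt_mean a (fun y => c * phi y) = c * tilt_mean a phi.
Proof. by move=> b1; rewrite /tilt_mean tilt_intZ// mulrA. Qed.

Lemma tilt_mean_le phi psi : bounded_mfun phi -> bounded_mfun psi ->
  (forall y, S y -> phi y <= psi y) -> tilt_mean a phi <= tilt_mean a psi.
Proof.
move=> b1 b2 h; rewrite /tilt_mean ler_pM2r ?invr_gt0 ?tilt_int1_gt0//.
exact: tilt_int_le.
Qed.

Lemma tilt_mean_cst (c : R) : tilt_mean a (fun=> c) = c.
Proof.
have := tilt_meanZ c (bounded_mfun_cst 1).
under eq_fun do rewrite mulr1.
by move=> ->; rewrite /tilt_mean divff ?mulr1// gt_eqF// tilt_int1_gt0.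
Qed.

Lemma tilt_mean_bound phi M : bounded_mfun phi ->
  (forall y, S y -> `|phi y| <= M) -> `|tilt_mean a phi| <= M.
Proof.
move=> b1 h; rewrite ler_norml -{1}(tilt_mean_cst (- M)) -{2}(tilt_mean_cst M).
by apply/andP; split; apply: tilt_mean_le => //; try exact: bounded_mfun_cst;
  move=> y Sy; have := h _ Sy; rewrite ler_norml => /andP[].
Qed.

Lemma tilt_var_center phi (c : R) : bounded_mfun phi ->
  tilt_cov a phi phi =
  tilt_mean a (fun y => (phi y - c) ^+ 2) - (tilt_mean a phi - c) ^+ 2.
Proof.
move=> b1; have bc := bounded_mfun_cst.
have -> : (fun y => (phi y - c) ^+ 2) =
    (fun y => phi y * phi y + (- (2 * c)) * phi y + c * c).
  by apply/funext => y; ring.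
rewrite !tilt_meanD ?tilt_meanZ ?tilt_mean_cst /tilt_cov//.
- by ring.
- exact: bounded_mfunM.
- by apply: bounded_mfunM.
- by apply: bounded_mfunD; apply: bounded_mfunM.
Qed.

Lemma tilt_var_ge0 phi : bounded_mfun phi -> 0 <= tilt_cov a phi phi.
Proof.
move=> b1; have bc := bounded_mfun_cst.
rewrite (tilt_var_center (tilt_mean a phi))// subrr expr0n/= subr0.
rewrite -[leLHS](tilt_mean_cst 0); apply: tilt_mean_le => // [|y _].
  by apply: bounded_mfunM; apply: bounded_mfunD.
exact: sqr_ge0.
Qed.

(** Popoviciu's inequality: the variance is at most the mean square distance to
    the midpoint of the range. *)
Lemma tilt_var_le phi (A : R) : bounded_mfun phi ->
  (forall y y', S y -> S y' -> phi y - phi y' <= A) ->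
  tilt_cov a phi phi <= A ^+ 2 / 4.
Proof.
move=> b1 osc; have bc := bounded_mfun_cst.
have [y0 Sy0] : S !=set0.
  apply/set0P/eqP => S0; move: nuS; rewrite S0 measure0 => /eqP.
  by rewrite eq_sym onee_eq0.
pose s := sup (phi @` S); pose i := inf (phi @` S).
have hub y : S y -> has_ubound (phi @` S) /\ has_lbound (phi @` S).
  move=> Sy; split.
    by exists (phi y + A) => _ [z Sz <-]; rewrite -lerBlDl osc.
  by exists (phi y - A) => _ [z Sz <-]; rewrite lerBlDr -lerBlDl osc.
have phis y : S y -> phi y <= s.
  by move=> Sy; apply: ub_le_sup; [exact: (hub _ Sy).1|exists y].
have phii y : S y -> i <= phi y.
  by move=> Sy; apply: ge_inf; [exact: (hub _ Sy).2|exists y].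
have si : s - i <= A.
  rewrite lerBlDr; apply: ge_sup; first by exists (phi y0), y0.
  move=> _ [y Sy <-]; rewrite -lerBlDl.
  apply: lb_le_inf; first by exists (phi y0), y0.
  by move=> _ [z Sz <-]; rewrite lerBlDl -lerBlDr osc.
rewrite (tilt_var_center ((s + i) / 2))// lerBlDr.
apply: (@le_trans _ _ (A ^+ 2 / 4)); last by rewrite lerDl sqr_ge0.
rewrite -[leRHS]tilt_mean_cst; apply: tilt_mean_le => //.
  by apply: bounded_mfunM; apply: bounded_mfunD.
move=> y Sy.
have h1 : phi y <= s by exact: phis.
have h2 : i <= phi y by exact: phii.
have h3 : 0 <= (s - phi y) * (phi y - i) by rewrite mulr_ge0 ?subr_ge0.
have h4 : (s - i) ^+ 2 <= A ^+ 2.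
  have si0 : 0 <= s - i by rewrite subr_ge0 (le_trans h2).
  by rewrite ler_pXn2r// nnegrE (le_trans si0).
nra.
Qed.

(** Polarization: four times the covariance is the variance of the sum minus
    that of the difference, which is nonnegative. *)
Lemma tilt_cov_le phi psi (A : R) : bounded_mfun phi -> bounded_mfun psi ->
  (forall y y', S y -> S y' ->
    (phi y + psi y) - (phi y' + psi y') <= A) ->
  tilt_cov a phi psi <= A ^+ 2 / 16.
Proof.
move=> b1 b2 osc.
have bm := bounded_mfunM; have bD := bounded_mfunD; have bc := bounded_mfun_cst.
have bN : bounded_mfun (fun y => -1 * psi y) by exact: bm.
have h1 := tilt_var_le (bD _ _ b1 b2) osc.
have h2 := tilt_var_ge0 (bD _ _ b1 bN).
suff E : tilt_cov a (fun y => phi y + psi y) (fun y => phi y + psi y) -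
    tilt_cov a (fun y => phi y + -1 * psi y) (fun y => phi y + -1 * psi y) =
    4 * tilt_cov a phi psi by lra.
have E2 (c : R) : bounded_mfun (fun y => c * psi y) ->
    tilt_cov a (fun y => phi y + c * psi y) (fun y => phi y + c * psi y) =
    tilt_cov a phi phi + 2 * c * tilt_cov a phi psi + c ^+ 2 * tilt_cov a psi
      psi.
  move=> bcp; rewrite /tilt_cov.
  have b11 := bm _ _ b1 b1; have b12 := bm _ _ (bc (2 * c)) (bm _ _ b1 b2).
  have b22 := bm _ _ (bc (c ^+ 2)) (bm _ _ b2 b2).
  have -> : (fun y => (phi y + c * psi y) * (phi y + c * psi y)) =
      (fun y => phi y * phi y + (2 * c) * (phi y * psi y)
                + (c ^+ 2) * (psi y * psi y)).
    by apply/funext => y; ring.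
  rewrite !tilt_meanD// ?tilt_meanZ//; [by ring|exact: bm..|exact: bD].
rewrite E2//.
have -> : (fun y => phi y + psi y) = (fun y => phi y + 1 * psi y).
  by apply/funext => y; rewrite mul1r.
rewrite E2; last exact: bm.
by ring.
Qed.
End basics.
End tilt.

Section tilt_derivative.
Context d (T : measurableType d) (R : realType).
Variables (nu : probability T R) (S : set T).
Hypotheses (mS : measurable S) (nuS : nu S = 1%E).
Variables a b : T -> R.
Hypotheses (ba : bounded_mfun S a) (bb : bounded_mfun S b).

Let ar (r : R) (y : T) := a y + r * b y.

Let bar r : bounded_mfun S (ar r).
Proof.
by apply: bounded_mfunD => //; apply: bounded_mfunM => //;
  exact: bounded_mfun_cst.
Qed.

Let derive_integrand (phi : T -> R) (y : T) (r : R) :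
  is_derive r (1 : R) (fun r => phi y * expR (ar r y))
    (phi y * b y * expR (ar r y)).
Proof.
rewrite /ar; apply: is_derive_eq.
rewrite /GRing.scale/=; ring.
Qed.

Lemma is_derive_tilt_int (phi : T -> R) (r : R) : bounded_mfun S phi ->
  is_derive r (1 : R) (fun r => tilt_int nu S (ar r) phi)
    (tilt_int nu S (ar r) (fun y => phi y * b y)).
Proof.
move=> bp.
have [ma [Ma aM]] := ba; have [mb [Mb bM]] := bb; have [mp [Mp pM]] := bp.
have int1 psi r' : bounded_mfun S psi ->
    nu.-integrable S (EFin \o (fun y => psi y * expR (ar r' y))).
  move=> bpsi; apply: (bounded_mfun_integrable mS nuS).
  by apply: bounded_mfunM => //; exact: bounded_mfun_exp.
pose f (r : R) y := phi y * expR (ar r y).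
have p1E r' y : partial1of2 f r' y = phi y * b y * expR (ar r' y).
  rewrite partial1of2E; exact: (@derive_val _ _ _ _ _ _ _ (derive_integrand _ _
    _)).
(* Bounds the derivative uniformly over the unit neighbourhood of [r]. *)
pose C := `|Mp| * `|Mb| * expR (`|Ma| + (`|r| + 1) * `|Mb|).
have Ir : (`]r - 1, r + 1[%classic : set R) r.
  by rewrite /= in_itv/=; lra.
have dI r' y : derivable (f ^~ y) r' 1.
  exact: (@ex_derive _ _ _ _ _ _ _ (derive_integrand phi y r')).
have bnd r' y : (`]r - 1, r + 1[%classic : set R) r' -> S y ->
    `|partial1of2 f r' y| <= C.
  rewrite /= in_itv/= => /andP[r1 r2] Sy; rewrite p1E !normrM.
  rewrite /C; apply: ler_pM; rewrite ?mulr_ge0//.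
    by apply: ler_pM => //; [apply: le_trans (pM _ Sy) _|apply: le_trans (bM _
      Sy) _];
      exact: ler_norm.
  rewrite ger0_norm ?expR_ge0// ler_expR /ar lerD//.
    exact: le_trans (ler_norm _) (le_trans (aM _ Sy) (ler_norm _)).
  rewrite (le_trans (ler_norm _))// normrM; apply: ler_pM => //.
    have := ler_norm r; have := ler_norm (- r); rewrite normrN ler_norml; lra.
  exact: le_trans (bM _ Sy) (ler_norm _).
have intC : nu.-integrable S (EFin \o (fun=> C)).
  exact/(bounded_mfun_integrable mS nuS)/bounded_mfun_cst.
have C0 (y : T) : 0 <= C by rewrite /C !mulr_ge0// expR_ge0.
have dF : derivable (fun r' => \int[nu]_(y in S) f r' y) r 1.
  apply: (derivable_under_integral mS Ir _ _ C0 intC) => // r' _.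
  exact: int1.
apply: DeriveDef => //.
rewrite -derive1E (differentiation_under_integral mS Ir _ _ C0 intC)//.
  by apply: eq_Rintegral => y _; rewrite p1E.
by move=> r' _; exact: int1.
Qed.

Let Z0 r : tilt_int nu S (ar r) (fun=> 1) != 0.
Proof. by rewrite gt_eqF// tilt_int1_gt0. Qed.

Lemma is_derive_tilt_mean (phi : T -> R) (r : R) : bounded_mfun S phi ->
  is_derive r (1 : R) (fun r => tilt_mean nu S (ar r) phi)
    (tilt_cov nu S (ar r) phi b).
Proof.
move=> bp; have d1 := is_derive_tilt_int r bp.
have d2 := is_derive_tilt_int r (bounded_mfun_cst S 1).
have d3 := is_deriveV (Z0 r) d2.
apply: (is_derive_eq (is_deriveM d1 d3)).
have -> : (fun y => 1 * b y) = b by apply/funext => y; rewrite mul1r.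
rewrite /tilt_cov /tilt_mean /GRing.scale/=; field; exact: Z0.
Qed.

Lemma is_derive_ln_tilt_int (r : R) :
  is_derive r (1 : R) (fun r => ln (tilt_int nu S (ar r) (fun=> 1)))
    (tilt_mean nu S (ar r) b).
Proof.
have d2 := is_derive_tilt_int r (bounded_mfun_cst S 1).
have d3 := is_derive1_ln (tilt_int1_gt0 mS nuS (bar r)).
apply: (is_derive_eq (is_derive1_comp d3 d2)).
have -> : (fun y => 1 * b y) = b by apply/funext => y; rewrite mul1r.
by rewrite /tilt_mean mulrC.
Qed.

Lemma tilt_mean_increment_le (phi : T -> R) (c : R) : bounded_mfun S phi ->
  (forall r, tilt_cov nu S (ar r) phi b <= c) ->
  tilt_mean nu S (fun y => a y + b y) phi - tilt_mean nu S a phi <= c.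
Proof.
move=> bp cov; pose g r := tilt_mean nu S (ar r) phi.
have dg r : is_derive r (1 : R) g (tilt_cov nu S (ar r) phi b).
  exact: is_derive_tilt_mean.
have cg : {within `[0, 1], continuous g}.
  apply: derivable_within_continuous => r _.
  exact: (@ex_derive _ _ _ _ _ _ _ (dg r)).
have [r _] := MVT ltr01 (fun r _ => dg r) cg.
rewrite subr0 mulr1 /g /ar.
under [X in tilt_mean _ _ X _ - _]eq_fun do rewrite mul1r.
under [X in _ - tilt_mean _ _ X _]eq_fun do rewrite mul0r addr0.
by move=> ->; exact: cov.
Qed.

End tilt_derivative.

(** * The Euclidean norm *)

Section enorm.
Context {R : realType} {d : nat}.
Implicit Types u v : 'rV[R]_d.

Lemma dotZr (a : R) u v : dot u (a *: v) = a * dot u v.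
Proof. by rewrite dotC dotZl dotC. Qed.

Lemma dotDr u v w : dot w (u + v) = dot w u + dot w v.
Proof. by rewrite dotC dotDl ![dot _ w]dotC. Qed.

Lemma dotBr u v w : dot w (u - v) = dot w u - dot w v.
Proof. by rewrite dotC dotBl ![dot _ w]dotC. Qed.

Lemma dot0r u : dot u 0 = 0.
Proof. by rewrite /dot big1// => i _; rewrite mxE mulr0. Qed.

Lemma dot_ge0 u : 0 <= dot u u.
Proof. by apply: sumr_ge0 => i _; rewrite -expr2 sqr_ge0. Qed.

Lemma enorm_ge0 u : 0 <= enorm u. Proof. exact: sqrtr_ge0. Qed.

Lemma enorm_sqr u : enorm u ^+ 2 = dot u u.
Proof.
rewrite /enorm sqr_sqrtr; last by apply: sumr_ge0 => i _; rewrite sqr_ge0.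
by apply: eq_bigr => i _; rewrite expr2.
Qed.

Lemma normr_coord_le_enorm u i : `|u ord0 i| <= enorm u.
Proof.
rewrite -(ler_pXn2r (n := 2))// ?nnegrE ?enorm_ge0// enorm_sqr /dot.
rewrite (bigD1 i)//= -expr2 real_normK ?num_real// lerDl.
by apply: sumr_ge0 => j _; rewrite -expr2 sqr_ge0.
Qed.

Lemma enorm_eq0 u : enorm u = 0 -> u = 0.
Proof.
move=> u0; apply/rowP => i; rewrite mxE; apply/eqP; rewrite -normr_le0 -u0.
exact: normr_coord_le_enorm.
Qed.

Lemma enorm0 : enorm (0 : 'rV[R]_d) = 0.
Proof. by apply/eqP; rewrite -sqrf_eq0 enorm_sqr dot0r. Qed.

Lemma enormZ (a : R) u : enorm (a *: u) = `|a| * enorm u.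
Proof.
apply/eqP; rewrite -(eqrXn2 (n := 2))// ?mulr_ge0 ?enorm_ge0//.
by rewrite exprMn !enorm_sqr dotZl dotZr mulrA real_normK ?num_real// expr2.
Qed.

Lemma enormN u : enorm (- u) = enorm u.
Proof. by rewrite -scaleN1r enormZ normrN1 mul1r. Qed.

Lemma dot_le_enorm u v : dot u v <= enorm u * enorm v.
Proof.
have [/enorm_eq0 ->|u0] := eqVneq (enorm u) 0.
  by rewrite dotC dot0r enorm0 mul0r.
have [/enorm_eq0 ->|v0] := eqVneq (enorm v) 0.
  by rewrite dot0r enorm0 mulr0.
have uv : 0 < enorm u * enorm v by rewrite mulr_gt0// lt0r ?u0 ?v0 enorm_ge0.
have := dot_ge0 (enorm v *: u - enorm u *: v).
rewrite dotBl !dotBr !dotZl !dotZr -!enorm_sqr [dot v u]dotC.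
rewrite (_ : _ - _ = 2 * ((enorm u * enorm v) * (enorm u * enorm v - dot u v))).
  by rewrite pmulr_rge0// pmulr_rge0// subr_ge0.
by ring.
Qed.

Lemma enormD u v : enorm (u + v) <= enorm u + enorm v.
Proof.
rewrite -(ler_pXn2r (n := 2))// ?nnegrE ?addr_ge0 ?enorm_ge0//.
rewrite enorm_sqr dotDl !dotDr -!enorm_sqr [dot v u]dotC.
have := dot_le_enorm u v; nra.
Qed.

Lemma enorm_le_sum u : enorm u <= \sum_(i < d) `|u ord0 i|.
Proof.
rewrite -(ler_pXn2r (n := 2))// ?nnegrE ?enorm_ge0 ?sumr_ge0// enorm_sqr.
rewrite expr2 mulr_sumr; apply: ler_sum => i _.
rewrite -expr2 -real_normK ?num_real// expr2 ler_wpM2r//.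
by rewrite (bigD1 i)//= lerDl sumr_ge0.
Qed.

End enorm.

(** * The drift as the mean of a tilted measure *)

Section support.
Context {R : realType} {d : nat}.
Variable nu : probability 'rV[R]_d R.

(** The complement of the support is a union of uncountably many null open sets;
    rational balls make this union countable. *)
Lemma supp_cover : exists F : nat -> set 'rV[R]_d,
  [/\ forall k, measurable (F k), forall k, nu (F k) = 0%E
    & ~` supp nu = \bigcup_k F k].
Proof.
pose B (p : 'M[rat]_(1, d) * nat) : set 'rV[R]_d :=
  let A := ball (map_mx ratr p.1 : 'rV[R]_d) p.2.+1%:R^-1 in
  if nu A == 0%E then A else set0.
pose F k := if unpickle k is Some p then B p else set0.
have oB p : open (B p).
  rewrite /B; case: ifP => _; last exact: open0.
  by apply: ball_open; rewrite invr_gt0 ltr0n.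
have nuB p : nu (B p) = 0%E by rewrite /B; case: eqP => // _; rewrite measure0.
exists F; split => [k|k|].
- by rewrite /F; case: unpickle => // p; exact: open_measurable_mx.
- by rewrite /F; case: unpickle => [p|]; rewrite ?measure0.
apply/seteqP; split => [x|x [k _]].
- rewrite /supp /= -existsNE => -[U /not_implyP[oU /not_implyP[Ux /negP nuU]]].
  have nuU0 : nu U = 0%E.
    by apply/eqP; rewrite eq_le measure_ge0 andbT leNgt.
  move: Ux; rewrite {1}(open_bigcup_ball oU) => -[p _].
  case: asboolP => // pU px; exists (pickle p) => //.
  rewrite /F pickleK /B ifT//.
  rewrite eq_le measure_ge0 andbT -nuU0 le_measure// inE.
    by apply: open_measurable_mx; apply: ball_open; rewrite invr_gt0 ltr0n.
  exact: open_measurable_mx.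
- rewrite /F; case: unpickle => // p Bx /(_ _ (oB p) Bx).
  by rewrite nuB ltxx.
Qed.

Lemma measurable_supp : measurable (supp nu).
Proof.
have [F [mF _ E]] := supp_cover.
by rewrite -[supp nu]setCK E; apply: measurableC; exact: bigcup_measurable.
Qed.

Lemma probability_suppC : nu (~` supp nu) = 0%E.
Proof.
have [F [mF F0 ->]] := supp_cover.
apply/(measure_negligible (bigcup_measurable (fun k _ => mF k))).
by apply: negligible_bigcup => k; apply/negligibleP; [exact: mF|exact: F0].
Qed.

Lemma probability_supp : nu (supp nu) = 1%E.
Proof.
have := probability_setC nu (measurableC measurable_supp).
by rewrite setCK probability_suppC sube0.
Qed.

Lemma Rintegral_supp (g : 'rV[R]_d -> R) : measurable_fun setT g ->
  (forall y, 0 <= g y) -> \int[nu]_y g y = \int[nu]_(y in supp nu) g y.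
Proof.
move=> mg g0; congr fine.
rewrite (ge0_negligible_integral (measurableC measurable_supp) measurableT)//.
- by rewrite setTD setCK.
- exact/measurable_EFinP.
- by move=> y _; rewrite lee_fin.
- exact: probability_suppC.
Qed.

Hypothesis diam_lty : (diam (supp nu) < +oo)%E.
Let r := fine (diam (supp nu)).

Lemma enorm_supp_le y y' : supp nu y -> supp nu y' -> enorm (y - y') <= r.
Proof.
move=> Sy Sy'.
have le_diam : ((enorm (y - y'))%:E <= diam (supp nu))%E.
  by apply: ereal_sup_ubound; exists (y, y').
have fin : diam (supp nu) \is a fin_num.
  by rewrite fin_real// diam_lty andbT (lt_le_trans _ le_diam)// ltNyr.
by rewrite -lee_fin /r fineK.
Qed.

Lemma supp_nonempty : supp nu !=set0.
Proof.
apply/set0P/eqP => S0; have := probability_supp; rewrite S0 measure0 => /eqP.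
by rewrite eq_sym onee_eq0.
Qed.

Lemma diam_supp_ge0 : 0 <= r.
Proof.
by have [y Sy] := supp_nonempty; apply: le_trans (enorm_supp_le Sy Sy);
  exact: enorm_ge0.
Qed.

Lemma supp_bounded : exists M, forall y, supp nu y -> enorm y <= M.
Proof.
have [y0 Sy0] := supp_nonempty; exists (r + enorm y0) => y Sy.
rewrite -{1}(subrK y0 y) (le_trans (enormD _ _))// lerD2r.
exact: enorm_supp_le.
Qed.

Lemma bounded_dot u : bounded_mfun (supp nu) (dot u).
Proof.
have [M hM] := supp_bounded; split; first exact: measurable_dotr.
exists (enorm u * M) => y Sy; rewrite ler_norml.
have := dot_le_enorm u y; have := dot_le_enorm (- u) y.
rewrite dotNl enormN lerNl => h1 h2.
have h3 : enorm u * enorm y <= enorm u * M by rewrite ler_wpM2l ?enorm_ge0 ?hM.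
by rewrite (le_trans _ h1) ?lerN2//= (le_trans h2).
Qed.

Lemma bounded_dotrr : bounded_mfun (supp nu) (fun y => dot y y / 2).
Proof.
have [M hM] := supp_bounded; split.
  by apply: measurable_funM => //; exact: measurable_dotrr.
exists (M ^+ 2 / 2) => y Sy; rewrite -enorm_sqr.
have h : enorm y ^+ 2 <= M ^+ 2.
  by rewrite ler_pXn2r ?nnegrE ?enorm_ge0 ?hM// (le_trans (enorm_ge0 y))// hM.
by rewrite ger0_norm; have := sqr_ge0 (enorm y); lra.
Qed.

Lemma bounded_coord i : bounded_mfun (supp nu) (fun y : 'rV[R]_d => y ord0 i).
Proof.
have [M hM] := supp_bounded; split; first exact: measurable_coord.
exists M => y Sy; exact: le_trans (normr_coord_le_enorm _ _) (hM _ Sy).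
Qed.

(** Up to terms free of [y], the log-likelihood of [y] when [x] is observed as a
    sample of [t y + B_t]. The tilt of the prior [nu] is thus the posterior law
    of [y]. *)
Definition tilt_exponent (t : R) (x y : 'rV[R]_d) : R :=
  dot x y - t * (dot y y / 2).

Definition posterior_mean (t : R) (x : 'rV[R]_d) : 'rV[R]_d :=
  \row_i tilt_mean nu (supp nu) (tilt_exponent t x) (fun y => y ord0 i).

Lemma bounded_tilt_exponent t x : bounded_mfun (supp nu) (tilt_exponent t x).
Proof.
have -> : tilt_exponent t x = (fun y => dot x y + (- t) * (dot y y / 2)).
  by apply/funext => y; rewrite /tilt_exponent mulNr.
apply: bounded_mfunD; first exact: bounded_dot.
by apply: bounded_mfunM; [exact: bounded_mfun_cst|exact: bounded_dotrr].
Qed.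

Let mS := measurable_supp.
Let nuS := probability_supp.

Lemma tilt_mean_dot t x v :
  tilt_mean nu (supp nu) (tilt_exponent t x) (dot v) = dot v (posterior_mean t
    x).
Proof.
have ba := bounded_tilt_exponent t x.
suff [] : tilt_mean nu (supp nu) (tilt_exponent t x) (dot v) =
    dot v (posterior_mean t x) /\ bounded_mfun (supp nu) (dot v) by [].
rewrite /dot; elim: (index_enum _) => [|i s [IH bs]].
  under eq_fun do rewrite big_nil.
  rewrite big_nil tilt_mean_cst//; split => //; exact: bounded_mfun_cst.
under eq_fun do rewrite big_cons.
have bi : bounded_mfun (supp nu) (fun y : 'rV[R]_d => v ord0 i * y ord0 i).
  by apply: bounded_mfunM; [exact: bounded_mfun_cst|exact: bounded_coord].
split; last exact: bounded_mfunD.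
rewrite tilt_meanD// IH tilt_meanZ//; last exact: bounded_coord.
by rewrite big_cons mxE.
Qed.

(** The exponent is affine in [(t, x)], so that moving along a segment of
    space-time is a tilt in a fixed direction. *)
Lemma tilt_exponent_increment t x t' x' :
  tilt_exponent t' x' =
  (fun y => tilt_exponent t x y + (dot (x' - x) y + (t - t') * (dot y y / 2))).
Proof. by apply/funext => y; rewrite /tilt_exponent dotBl; ring. Qed.

Lemma bounded_increment (u : 'rV[R]_d) (s : R) :
  bounded_mfun (supp nu) (fun y => dot u y + s * (dot y y / 2)).
Proof.
apply: bounded_mfunD; first exact: bounded_dot.
by apply: bounded_mfunM; [exact: bounded_mfun_cst|exact: bounded_dotrr].
Qed.

(** The Jacobian of the posterior mean is the posterior covariance matrix, whose
    operator norm is at most [r ^+ 2 / 4] by Popoviciu's inequality. The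
    increment [v] of the mean is tested against itself. *)
Lemma posterior_mean_lipschitz t x x' :
  enorm (posterior_mean t x' - posterior_mean t x) <=
  r ^+ 2 / 4 * enorm (x' - x).
Proof.
set v := posterior_mean t x' - posterior_mean t x; set u := x' - x.
have [v0|v0] := eqVneq (enorm v) 0.
  by rewrite v0 mulr_ge0 ?enorm_ge0 ?divr_ge0 ?sqr_ge0.
have [/enorm_eq0 u0|u0] := eqVneq (enorm u) 0.
  move: u0 => /eqP; rewrite subr_eq0 => /eqP xx.
  by move: v0; rewrite /v xx subrr enorm0 eqxx.
have pv : 0 < enorm v by rewrite lt0r v0 enorm_ge0.
have pu : 0 < enorm u by rewrite lt0r u0 enorm_ge0.
(* Polarizing loses nothing only if both directions have the same length, hence
   the rescalings by [enorm u] and [enorm v]. *)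
suff : enorm u * dot v v <= enorm u * (r ^+ 2 / 4 * enorm u * enorm v).
  by rewrite ler_pM2l// -enorm_sqr expr2 ler_pM2r.
have bu := bounded_dot u; have bv := bounded_dot v.
have bc := bounded_mfun_cst.
have -> : dot v v = tilt_mean nu (supp nu) (tilt_exponent t x') (dot v) -
    tilt_mean nu (supp nu) (tilt_exponent t x) (dot v).
  by rewrite !tilt_mean_dot -dotBr.
rewrite mulrBr -!tilt_meanZ//; try exact: bounded_tilt_exponent.
have -> : tilt_exponent t x' = (fun y => tilt_exponent t x y + dot u y).
  rewrite (tilt_exponent_increment t x); apply/funext => y.
  by rewrite subrr mul0r addr0.
apply: tilt_mean_increment_le => //.
- exact: bounded_tilt_exponent.
- by apply: bounded_mfunM.
move=> p.
set a := fun y => _ + _.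
have ba : bounded_mfun (supp nu) a.
  apply: bounded_mfunD; first exact: bounded_tilt_exponent.
  by apply: bounded_mfunM.
suff : enorm v * tilt_cov nu (supp nu) a (fun y => enorm u * dot v y) (dot u) <=
    enorm v * (enorm u * (r ^+ 2 / 4 * enorm u * enorm v)).
  by rewrite ler_pM2l.
have -> : enorm v * tilt_cov nu (supp nu) a (fun y => enorm u * dot v y) (dot u)
    = tilt_cov nu (supp nu) a (fun y => enorm u * dot v y)
        (fun y => enorm v * dot u y).
  rewrite /tilt_cov [tilt_mean _ _ _ (fun y => enorm v * dot u y)]tilt_meanZ//.
  have -> : (fun y => enorm u * dot v y * (enorm v * dot u y)) =
      (fun y => enorm v * (enorm u * dot v y * dot u y)).
    by apply/funext => y; ring.
  rewrite [tilt_mean _ _ _ (fun y => enorm v * (_ * _))]tilt_meanZ//;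
    last first.
    by do 2 apply: bounded_mfunM => //.
  by rewrite tilt_meanZ//; ring.
have -> : enorm v * (enorm u * (r ^+ 2 / 4 * enorm u * enorm v)) =
    (r * (2 * (enorm u * enorm v))) ^+ 2 / 16 by field.
apply: tilt_cov_le => //; try by apply: bounded_mfunM.
move=> y y' Sy Sy'.
rewrite -!dotZl -!dotDl -dotBr (le_trans (dot_le_enorm _ _))// mulrC.
apply: ler_pM; rewrite ?enorm_ge0 ?enorm_supp_le// (le_trans (enormD _ _))//.
by rewrite !enormZ !ger0_norm ?enorm_ge0// [enorm v * _]mulrC mulr2n mulrDl
  mul1r.
Qed.

Lemma posterior_mean_bounded :
  exists M, forall t x i, `|posterior_mean t x ord0 i| <= M.
Proof.
have [M hM] := supp_bounded; exists M => t x i; rewrite mxE.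
apply: tilt_mean_bound => //; [exact: bounded_tilt_exponent|exact:
  bounded_coord|].
by move=> y Sy; exact: le_trans (normr_coord_le_enorm _ _) (hM _ Sy).
Qed.

(** A covariance is at most twice the product of the bounds of its arguments.
    This crude estimate provides the continuity of the drift in time. *)
Lemma posterior_mean_joint_lipschitz : exists2 K, 0 <= K &
  forall t x t' x' i,
    posterior_mean t' x' ord0 i - posterior_mean t x ord0 i <=
    K * (enorm (x' - x) + `|t' - t|).
Proof.
have [M hM] := supp_bounded.
have [y0 Sy0] := supp_nonempty.
have M0 : 0 <= M := le_trans (enorm_ge0 _) (hM _ Sy0).
exists (2 * M * (M + M ^+ 2)); first by rewrite mulr_ge0 ?addr_ge0 ?sqr_ge0
  ?mulr_ge0.
move=> t x t' x' i; rewrite !mxE (tilt_exponent_increment t x).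
have bc := bounded_coord i.
apply: tilt_mean_increment_le => //.
- exact: bounded_tilt_exponent.
- exact: bounded_increment.
move=> p; set a := fun y => _ + p * _; set b := fun y => dot _ _ + _.
have bb : bounded_mfun (supp nu) b by exact: bounded_increment.
have ba : bounded_mfun (supp nu) a.
  apply: bounded_mfunD; first exact: bounded_tilt_exponent.
  by apply: bounded_mfunM => //; exact: bounded_mfun_cst.
set e := enorm (x' - x) + `|t' - t|.
have e0 : 0 <= e by rewrite addr_ge0 ?enorm_ge0.
have cM y : supp nu y -> `|y ord0 i| <= M.
  by move=> Sy; exact: le_trans (normr_coord_le_enorm _ _) (hM _ Sy).
have bM y : supp nu y -> `|b y| <= (M + M ^+ 2) * e.
  move=> Sy; rewrite /b (le_trans (ler_normD _ _))//.
  have h1 : `|dot (x' - x) y| <= enorm (x' - x) * M.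
    have h u : dot u y <= enorm u * M.
      by rewrite (le_trans (dot_le_enorm _ _))// ler_wpM2l ?enorm_ge0 ?hM.
    by rewrite ler_norml h andbT lerNl -dotNl -[in leRHS]enormN h.
  have h2 : `|(t - t') * (dot y y / 2)| <= `|t' - t| * M ^+ 2.
    rewrite normrM distrC ler_wpM2l// -enorm_sqr.
    have h : enorm y ^+ 2 <= M ^+ 2.
      by rewrite ler_pXn2r ?nnegrE ?enorm_ge0 ?hM// (le_trans (enorm_ge0 y))//
        hM.
    by rewrite ger0_norm; have := sqr_ge0 (enorm y); lra.
  have := enorm_ge0 (x' - x); have := normr_ge0 (t' - t); have := sqr_ge0 M.
  rewrite /e; nra.
rewrite /tilt_cov.
have m1 : `|tilt_mean nu (supp nu) a (fun y => y ord0 i * b y)| <=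
    M * ((M + M ^+ 2) * e).
  apply: tilt_mean_bound => //; first exact: bounded_mfunM.
  by move=> y Sy; rewrite normrM ler_pM// ?cM ?bM.
have m2 : `|tilt_mean nu (supp nu) a (fun y => y ord0 i) *
    tilt_mean nu (supp nu) a b| <= M * ((M + M ^+ 2) * e).
  rewrite normrM ler_pM//; apply: tilt_mean_bound => //.
rewrite (le_trans (ler_norm _))// (le_trans (ler_normB _ _))//.
rewrite (_ : _ * e = M * ((M + M ^+ 2) * e) + M * ((M + M ^+ 2) * e)).
  exact: lerD.
by ring.
Qed.

(** The logarithmic derivative of a partition function is the tilted mean. At
    time 1 the heat flow is [f] itself, an arbitrary version of the density,
    which need not be differentiable. *)
Lemma follmer_driftE (f : 'rV[R]_d -> R) t x :
  is_density (convolution (gaussian d) nu) (gaussian d) f -> t < 1 ->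
  follmer_drift f t x = posterior_mean t x.
Proof.
move=> pf t1; apply/rowP => i; rewrite !mxE.
have heatE z : heat (1 - t) f z =
    tilt_int nu (supp nu) (tilt_exponent t z) (fun=> 1).
  rewrite (heat_density pf) ?subr_gt0// Rintegral_supp; last 2 first.
  - apply: measurableT_comp => //; apply: measurable_funB.
      exact: measurable_dotr.
    apply: measurable_funM => //; apply: measurable_funM => //.
    exact: measurable_dotrr.
  - by move=> y; exact: expR_ge0.
  by apply: eq_Rintegral => y _; rewrite mul1r /tilt_exponent subKr.
have ba := bounded_tilt_exponent t x; have bi := bounded_coord i.
have D := is_derive_ln_tilt_int mS nuS ba bi 0.
have E : (fun y => tilt_exponent t x y + 0 * y ord0 i) = tilt_exponent t x.
  by apply/funext => y; rewrite mul0r addr0.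
rewrite E in D.
rewrite -(@derive_val _ _ _ _ _ _ _ D) /derive.
apply: (congr1 (fun g : R -> R => lim (g @ 0^'))); apply/funext => h /=.
have Eh : tilt_exponent t (h *: delta_mx ord0 i + x) =
    (fun y => tilt_exponent t x y + (h *: 1 + 0) * y ord0 i).
  apply/funext => y; rewrite (tilt_exponent_increment t x) subrr mul0r addr0.
  rewrite addrK dotZl addr0 [h%:A]mulr1; congr (_ + _ * _).
  rewrite /dot (bigD1 i)//= big1 => [|j ji]; rewrite !mxE ?eqxx ?mul1r ?addr0//.
  by rewrite (negbTE ji) andbF mul0r.
by rewrite !heatE Eh E.
Qed.

End support.

(** * Integrals of continuous functions and Gronwall's inequality *)

Section continuous_integral.
Context {R : realType}.
Notation mu := (@lebesgue_measure R).
Implicit Types (f g u k : R -> R).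

Lemma continuous_integrable f (a b : R) : continuous f ->
  mu.-integrable `[a, b] (EFin \o f).
Proof.
move=> cf; apply: continuous_compact_integrable; first exact: segment_compact.
exact: continuous_subspaceT.
Qed.

Lemma integrable_subsegment (f : R -> \bar R) (t : R) :
  mu.-integrable `[0, 1] f -> t \in `[0, 1] -> mu.-integrable `[0, t] f.
Proof.
rewrite in_itv/= => fi /andP[_ t1]; apply: integrableS fi => //.
by apply: subset_itvl; rewrite bnd_simp.
Qed.

Lemma Rintegral_increment_le f (M s t : R) : 0 <= s -> s <= t ->
  mu.-integrable `[0, t] (EFin \o f) ->
  (forall x, x \in `[0, t] -> `|f x| <= M) ->
  `|\int[mu]_(x in `[0, t]) f x - \int[mu]_(x in `[0, s]) f x| <= M * (t - s).
Proof.
move=> s0 st fi fM; rewrite Rintegral_itvB//; [|by rewrite bnd_simp..].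
have sub : `]s, t] `<=` `[0, t].
  by apply: subset_itvr; rewrite bnd_simp.
have fi' : mu.-integrable `]s, t] (EFin \o f) by exact: integrableS fi.
rewrite (le_trans (le_normr_Rintegral _ fi'))//.
have -> : M * (t - s) = \int[mu]_(x in `]s, t]) M.
  rewrite Rintegral_cst//= lebesgue_measure_itv/= lte_fin.
  by move: st; rewrite le_eqVlt => /predU1P[->|->]; rewrite ?ltxx ?subrr.
apply: le_Rintegral => //.
- exact: (integrable_norm fi').
- apply: (measurable_bounded_integrable (mu := mu)) => //.
  + by rewrite /= lebesgue_measure_itv/=; case: ifP => _; rewrite -?EFinB ltry.
  + by exists `|M|; split => // A MA x _; rewrite ltW.
- by move=> x /sub x0t; exact: fM.
Qed.

Lemma derivable_integral f (t : R) : continuous f -> 0 < t ->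
  is_derive t (1 : R) (fun t => \int[mu]_(s in `[0, t]) f s) (f t).
Proof.
move=> cf t0.
have tt : t < t + 1 by rewrite ltrDl.
have [d1 d2] := continuous_FTC1_closed tt (continuous_integrable 0 (t + 1) cf)
  t0 (cf t).
by apply: is_derive_eq (derivableP d1) _; rewrite -derive1E d2.
Qed.

Lemma within_continuous_integral f : continuous f ->
  {within `[0, 1], continuous (fun t => \int[mu]_(s in `[0, t]) f s)}.
Proof.
move=> cf; apply: (@parameterized_integral_continuous _ 0 1 f ler01).
exact: continuous_integrable.
Qed.

Lemma integral_segment0 f : \int[mu]_(s in `[(0:R), 0]) f s = 0.
Proof. by rewrite set_itv1 Rintegral_set1. Qed.

Lemma continuous_expRM (c : R) : continuous (fun s : R => expR (c * s)).
Proof.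
move=> s; apply: (continuous_comp (f := fun s => c * s));
  last exact: continuous_expR.
by apply: cvgM; [exact: cvg_cst|exact: cvg_id].
Qed.

(** With [W] the right-hand side of the hypothesis, the function
    [\int_0^t expR (- L s) k s - expR (- L t) W t] is nondecreasing. *)
Lemma continuous_gronwall (L e : R) u k : 0 <= L -> continuous u -> continuous
  k ->
  (forall t, t \in `[0, 1] ->
    u t <= e + \int[mu]_(s in `[0, t]) (L * u s + k s)) ->
  u 1 <= expR L * (e + \int[mu]_(s in `[0, 1]) (expR (- L * s) * k s)).
Proof.
move=> L0 cu ck h.
pose v s := L * u s + k s; pose j s := expR (- L * s) * k s.
have cv : continuous v.
  by move=> s; apply: cvgD; [apply: cvgM; [exact: cvg_cst|exact: cu]|exact: ck].
have cj : continuous j.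
  by move=> s; apply: cvgM; [exact: continuous_expRM|exact: ck].
pose W t := e + \int[mu]_(s in `[0, t]) v s.
pose G t := \int[mu]_(s in `[0, t]) j s - expR (- L * t) * W t.
have dG (t : R) : t \in `]0, 1[ ->
    is_derive t (1 : R) G (L * expR (- L * t) * (W t - u t)).
  rewrite in_itv/= => /andP[t0 t1].
  have d1 := derivable_integral cj t0; have d2 := derivable_integral cv t0.
  rewrite /G /W; apply: is_derive_eq.
  rewrite /GRing.scale/= /j /v; ring.
have cG : {within `[0, 1], continuous G}.
  move=> t; apply: cvgB; first exact: within_continuous_integral.
  apply: cvgM; first exact/continuous_subspaceT/continuous_expRM.
  by apply: cvgD; [exact: cvg_cst|exact: within_continuous_integral].
have := @ger0_derive1_ndecr R G 0 1 _ _ cG 0 1 (lexx _) ler01 (lexx _).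
have G0 : G 0 = - e.
  by rewrite /G /W !integral_segment0 mulr0 expR0 mul1r addr0 sub0r.
rewrite G0 => H.
have {H} : - e <= G 1.
  apply: H => t t01; have D := dG _ t01.
    exact: (@ex_derive _ _ _ _ _ _ _ D).
  rewrite derive1E (@derive_val _ _ _ _ _ _ _ D) !mulr_ge0 ?expR_ge0// subr_ge0.
  by apply: h; apply: subset_itv_oo_cc t01.
rewrite /G mulr1 expRN => H.
have u1 : u 1 <= W 1 by apply: h; rewrite in_itv/= ler01 lexx.
apply: (le_trans u1).
rewrite -ler_pdivrMl ?expR_gt0//; move: H; rewrite -/j; lra.
Qed.

End continuous_integral.

Section gronwall_l2.
Context {R : realType}.
Notation mu := (@lebesgue_measure R).
Implicit Types (f g u k : R -> R).

Let mI (a b : R) : measurable `[a, b]. Proof. by []. Qed.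

Let muI : (mu `[0%R, 1%R]%classic < +oo)%E.
Proof. by rewrite /= lebesgue_measure_itv/=; case: ifP => _;
  rewrite -?EFinB ltry. Qed.

Let exp_integrable (c : R) k : 0 <= c -> mu.-integrable `[0, 1] (EFin \o k) ->
  mu.-integrable `[0, 1] (EFin \o (fun s => expR (- c * s) * k s)).
Proof.
move=> c0 ik.
have mk : measurable_fun `[(0:R), 1] k.
  by apply/measurable_EFinP; exact: measurable_int ik.
have me : measurable_fun setT (fun s : R => expR (- c * s)).
  by apply: continuous_measurable_fun; exact: continuous_expRM.
apply: (le_integrable _ _ _ ik) => //.
  by apply/measurable_EFinP/measurable_funM => //; exact: measurable_funTS.
move=> s /=; rewrite in_itv/= => /andP[s0 _].
rewrite lee_fin normrM ger0_norm ?expR_ge0// ler_piMl//.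
by rewrite -expR0 ler_expR mulNr oppr_le0 mulr_ge0.
Qed.

(** For integrable [k] the right-hand side is merely absolutely continuous.
    Approximating [k] in mean by continuous functions avoids differentiating it. *)
Lemma integrable_gronwall (L : R) u k : 0 <= L -> continuous u ->
  mu.-integrable `[0, 1] (EFin \o k) ->
  (forall t, t \in `[0, 1] ->
    u t <= \int[mu]_(s in `[0, t]) (L * u s + k s)) ->
  u 1 <= expR L * \int[mu]_(s in `[0, 1]) (expR (- L * s) * k s).
Proof.
move=> L0 cu ik h.
have [kn [ckn ikn kncv]] := approximation_continuous_integrable (mI 0 1) muI ik.
have cLu : continuous (fun s => L * u s).
  by move=> s; apply: cvgM; [exact: cvg_cst|exact: cu].
pose e n := \int[mu]_(s in `[0, 1]) `|k s - kn n s|.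
have idn n : mu.-integrable `[0, 1] (EFin \o (fun s => k s - kn n s)).
  rewrite (_ : _ \o _ = (fun s => (k s)%:E - (kn n s)%:E)%E)//.
  exact: integrableB (ikn n).
have ian n : mu.-integrable `[0, 1] (EFin \o (fun s => `|k s - kn n s|)).
  exact: (integrable_norm (idn n)).
have ecv : e n @[n --> \oo] --> (0 : R).
  exact: (fine_cvg kncv).
pose I f := \int[mu]_(s in `[0, 1]) (expR (- L * s) * f s).
have bnd n : u 1 <= expR L * (I k + 2 * e n).
  apply: (@le_trans _ _ (expR L * (e n + I (kn n)))).
    apply: continuous_gronwall => // t t01; apply: (le_trans (h _ t01)).
    have sub f : mu.-integrable `[0, 1] (EFin \o f) -> mu.-integrable `[0, t]
      (EFin \o f).
      by move=> fi; exact: integrable_subsegment.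
    have iLu : mu.-integrable `[0, t] (EFin \o (fun s => L * u s)).
      exact: continuous_integrable.
    rewrite !RintegralD//; try by [exact: sub|apply: sub; exact: ikn].
    rewrite addrCA lerD2l -lerBlDr -RintegralB//;
      try by [exact: sub|apply: sub; exact: ikn].
    apply: (@le_trans _ _ (\int[mu]_(s in `[0, t]) `|k s - kn n s|)).
      apply: le_Rintegral => //; [exact: sub (idn n)|exact: sub (ian n)|].
      by move=> s _; exact: ler_norm.
    rewrite /e /Rintegral fine_le//.
    - by apply: integrable_fin_num => //; exact: sub (ian n).
    - by apply: integrable_fin_num => //; exact: ian.
    - apply: ge0_subset_integral => //.
      + by have := ian n; exact: measurable_int.
      + by apply: subset_itvl; rewrite bnd_simp; move: t01;
        rewrite in_itv/= => /andP[].
  rewrite ler_pM2l ?expR_gt0// (_ : I k + 2 * e n = e n + (I k + e n));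
    last by ring.
  rewrite lerD2l -lerBlDl /I -RintegralB//; try exact: exp_integrable.
  apply: (le_trans (ler_norm _)).
  have id' : mu.-integrable `[0, 1]
      (EFin \o (fun s => expR (- L * s) * kn n s - expR (- L * s) * k s)).
    rewrite (_ : _ \o _ = (fun s => (expR (- L * s) * kn n s)%:E
        - (expR (- L * s) * k s)%:E)%E)//.
    by apply: integrableB => //; exact: exp_integrable.
  apply: (le_trans (le_normr_Rintegral _ id')) => //.
  apply: le_Rintegral => //; first exact: (integrable_norm id').
  move=> s; rewrite /= in_itv/= => /andP[s0 _].
  rewrite -mulrBr normrM distrC ger0_norm ?expR_ge0// ler_piMl//.
  by rewrite -expR0 ler_expR mulNr oppr_le0 mulr_ge0.
have cvb : expR L * (I k + 2 * e n) @[n --> \oo] --> expR L * (I k + 2 * 0).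
  apply: cvgM; first exact: cvg_cst.
  apply: cvgD; first exact: cvg_cst.
  by apply: cvgM; [exact: cvg_cst|exact: ecv].
rewrite mulr0 addr0 in cvb.
by rewrite -(cvg_lim _ cvb)//; apply: limr_ge; [exact: cvgP cvb|near=> n;
  exact: bnd].
Unshelve. all: end_near. Qed.

Lemma le_sqrtM_of_young (x A B : R) : 0 <= A -> 0 <= B ->
  (forall l, 0 < l -> x <= (l * A + l^-1 * B) / 2) ->
  x <= Num.sqrt A * Num.sqrt B.
Proof.
move=> A0 B0 h; apply/ler_addgt0Pr => e e0.
set a := Num.sqrt A; set b := Num.sqrt B.
have a0 : 0 <= a by exact: sqrtr_ge0.
have b0 : 0 <= b by exact: sqrtr_ge0.
have aE : A = a ^+ 2 by rewrite sqr_sqrtr.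
have bE : B = b ^+ 2 by rewrite sqr_sqrtr.
(* The optimal [l] is [b / a]; shifting both terms by [q] keeps it defined and
   positive when [a] or [b] vanishes, at a cost [q * (a + b) / 2] below [e]. *)
pose q := e / (a + b + 1).
have q0 : 0 < q by apply: divr_gt0 => //; lra.
have bq0 : 0 < b + q by lra.
have aq0 : 0 < a + q by lra.
apply: (le_trans (h _ (divr_gt0 bq0 aq0))).
have h1 : (b + q) / (a + q) * A <= (b + q) * a.
  rewrite -mulrA ler_pM2l// ler_pdivrMl// aE; nra.
have h2 : ((b + q) / (a + q))^-1 * B <= (a + q) * b.
  rewrite invf_div -mulrA ler_pM2l// ler_pdivrMl// bE; nra.
have h3 : q * (a + b + 1) = e by rewrite /q divfK// gt_eqF//; lra.
nra.
Qed.

(** The Cauchy-Schwarz inequality, in the form of a Young inequality with a free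
    parameter. *)
Lemma exp_weight_l2 (L : R) k : 0 <= L ->
  mu.-integrable `[0, 1] (EFin \o k) ->
  mu.-integrable `[0, 1] (EFin \o (fun s => k s ^+ 2)) ->
  expR L * \int[mu]_(s in `[0, 1]) (expR (- L * s) * k s) <=
  Num.sqrt (expR (2 * L) * \int[mu]_(s in `[0, 1]) expR (- (2 * L) * s)) *
  Num.sqrt (\int[mu]_(s in `[0, 1]) (k s ^+ 2)).
Proof.
move=> L0 ik ik2; apply: le_sqrtM_of_young.
- by rewrite mulr_ge0 ?expR_ge0// Rintegral_ge0// => s _; exact: expR_ge0.
- by apply: Rintegral_ge0 => s _; exact: sqr_ge0.
move=> l l0.
have ie : mu.-integrable `[0, 1] (EFin \o (fun s => expR (- (2 * L) * s))).
  by apply: continuous_integrable; exact: continuous_expRM.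
have iM (c : R) f : mu.-integrable `[0, 1] (EFin \o f) ->
    mu.-integrable `[0, 1] (EFin \o (fun s => c * f s)).
  move=> fi; rewrite (_ : _ \o _ = (fun s => c%:E * (EFin \o f) s)%E)//.
  exact: integrableZl.
have iek := exp_integrable L0 ik.
rewrite -[leLHS]RintegralZl// [l * (_ * _)]mulrA -[l * _ * _]RintegralZl//.
rewrite -[l^-1 * _]RintegralZl// -RintegralD//; [|exact: iM..].
rewrite -RintegralZr//; last first.
  rewrite (_ : _ \o _ = (fun s => (l * expR (2 * L) * expR (- (2 * L) * s))%:E +
    (l^-1 * k s ^+ 2)%:E)%E)//.
  by apply: integrableD => //; exact: iM.
apply: le_Rintegral => //.
- exact: iM.
- rewrite (_ : _ \o _ = (fun s => 2^-1%:E * ((l * expR (2 * L) * expR (- (2 *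
  L) * s))%:E +
    (l^-1 * k s ^+ 2)%:E))%E); last first.
    by apply/funext => s /=; rewrite muleC.
  by apply: integrableZl => //; apply: integrableD => //; exact: iM.
move=> s _.
have -> : expR (2 * L) = expR L ^+ 2 by rewrite expRM_natl.
have -> : expR (- (2 * L) * s) = expR (- L * s) ^+ 2.
  by rewrite -expRM_natl; congr expR; ring.
set p := expR L; set q := expR _.
rewrite -subr_ge0 (_ : _ - _ = l^-1 * (l * p * q - k s) ^+ 2 / 2).
  apply: divr_ge0 => //; apply: mulr_ge0; last exact: sqr_ge0.
  by rewrite invr_ge0 ltW.
field; exact: lt0r_neq0.
Qed.

Lemma integral_expRM (c t : R) : c != 0 -> 0 <= t ->
  \int[mu]_(s in `[0, t]) expR (c * s) = (expR (c * t) - 1) / c.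
Proof.
move=> c0; rewrite le_eqVlt => /predU1P[<-|t0].
  by rewrite integral_segment0 mulr0 expR0 subrr mul0r.
pose F s := c^-1 * expR (c * s).
have dF (s : R) : is_derive s (1 : R) F (expR (c * s)).
  by rewrite /F; apply: is_derive_eq; rewrite /GRing.scale/=; field.
have cF : continuous F.
  by move=> s; apply: cvgM; [exact: cvg_cst|exact: continuous_expRM].
rewrite /Rintegral (continuous_FTC2 (F := F) t0).
- by rewrite /F mulr0 expR0 /=; field.
- by apply: continuous_subspaceT; exact: continuous_expRM.
- split.
  + by move=> s _; exact: (@ex_derive _ _ _ _ _ _ _ (dF s)).
  + by apply: cvg_at_right_filter; exact: cF.
  + by apply: cvg_at_left_filter; exact: cF.
- by move=> s _; rewrite derive1E (@derive_val _ _ _ _ _ _ _ (dF s)).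
Qed.

Lemma contraction_constant_weight (r : R) : 0 <= r ->
  Num.sqrt (expR (2 * (r ^+ 2 / 4)) *
    \int[mu]_(s in `[0, 1]) expR (- (2 * (r ^+ 2 / 4)) * s)) =
  contraction_constant r.
Proof.
move=> r0; rewrite /contraction_constant; case: eqVneq => [->|rn0].
  rewrite expr0n/= mul0r mulr0 expR0 mul1r.
  under eq_Rintegral do rewrite oppr0 mul0r expR0.
  rewrite Rintegral_cst//= lebesgue_measure_itv/= lte01 oppr0 adde0 mulr1.
  exact: sqrtr1.
set c := 2 * (r ^+ 2 / 4).
have cE : c = r ^+ 2 / 2 by rewrite /c; field.
have rp : 0 < r by rewrite lt0r rn0.
have c0 : 0 < c by rewrite cE divr_gt0// exprn_gt0.
have cn0 : c != 0 by rewrite gt_eqF.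
have -> : \int[mu]_(s in `[0, 1]) expR (- c * s) = (1 - expR (- c)) / c.
  by rewrite integral_expRM ?oppr_eq0// mulr1 invrN mulrN -mulNr opprB.
rewrite -cE.
have -> : expR c * ((1 - expR (- c)) / c) = (expR c - 1) * (2 / r ^+ 2).
  rewrite mulrA mulrBr mulr1 -expRD subrr expR0 cE; field; exact: rn0.
rewrite sqrtrM ?subr_ge0; last by rewrite -expR0 ler_expR ltW.
by rewrite sqrtrM// sqrtrV ?exprn_ge0// sqrtr_sqr ger0_norm.
Qed.

End gronwall_l2.

(** * Stability of the integral equation *)

Section curves.
Context {R : realType} {d : nat}.
Notation mu := (@lebesgue_measure R).
Implicit Types (X Y g h : R -> 'rV[R]_d).

Definition continuous_curve X := forall i, continuous (fun s => X s ord0 i).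

Lemma continuous_sum (T : topologicalType) n (f : 'I_n -> T -> R) :
  (forall i, continuous (f i)) -> continuous (fun s => \sum_(i < n) f i s).
Proof.
move=> cf; elim: n f cf => [|n IH] f cf s.
  by under eq_fun do rewrite big_ord0; exact: cst_continuous.
rewrite (_ : (fun _ => _) = (fun s => f ord0 s + \sum_(i < n) f (lift ord0 i)
  s)).
  by apply: continuousD; [exact: cf|apply: IH => i; exact: cf].
by apply/funext => s'; rewrite big_ord_recl.
Qed.

Lemma continuous_curveB X Y : continuous_curve X -> continuous_curve Y ->
  continuous_curve (fun s => X s - Y s).
Proof.
move=> cX cY i s.
rewrite (_ : (fun _ => _) = (fun s => X s ord0 i - Y s ord0 i)).
  by apply: cvgB; [exact: cX|exact: cY].
by apply/funext => s'; rewrite !mxE.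
Qed.

Lemma continuous_enorm X : continuous_curve X -> continuous (enorm \o X).
Proof.
move=> cX s; apply: (continuous_comp (g := Num.sqrt)
  (f := fun s => \sum_(i < d) X s ord0 i ^+ 2)); last exact: sqrt_continuous.
apply: continuous_sum => i {}s.
rewrite (_ : (fun _ => _) = (fun s => X s ord0 i * X s ord0 i)).
  by apply: cvgM; exact: cX.
by apply/funext => s'; rewrite expr2.
Qed.

Lemma vintB t g h :
  (forall i, mu.-integrable `[0, t] (EFin \o (fun s => g s ord0 i))) ->
  (forall i, mu.-integrable `[0, t] (EFin \o (fun s => h s ord0 i))) ->
  vint t (fun s => g s - h s) = vint t g - vint t h.
Proof.
move=> ig ih; apply/rowP => i; rewrite !mxE -RintegralB//.
by apply: eq_Rintegral => s _; rewrite !mxE.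
Qed.

Lemma integrable_dot t g v :
  (forall i, mu.-integrable `[0, t] (EFin \o (fun s => g s ord0 i))) ->
  mu.-integrable `[0, t] (EFin \o (fun s => dot v (g s))) /\
  dot v (vint t g) = \int[mu]_(s in `[0, t]) dot v (g s).
Proof.
move=> ig; rewrite /dot; elim: (index_enum _) => [|i s [IH1 IH2]].
  under [X in EFin \o X]eq_fun do rewrite big_nil.
  under eq_Rintegral do rewrite big_nil.
  rewrite big_nil; split; last by rewrite Rintegral_cst// mul0r.
  exact: (@integrable0 _ _ _ mu).
under [X in EFin \o X]eq_fun do rewrite big_cons.
under eq_Rintegral do rewrite big_cons.
have i1 : mu.-integrable `[0, t] (EFin \o (fun x => v ord0 i * g x ord0 i)).
  rewrite (_ : _ \o _ = (fun s => (v ord0 i)%:E * (g s ord0 i)%:E)%E)//.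
  by apply: integrableZl => //; exact: ig.
split.
  rewrite (_ : _ \o _ = (fun x => (v ord0 i * g x ord0 i)%:E
    + (\sum_(j <- s) v ord0 j * g x ord0 j)%:E)%E)//.
  exact: integrableD.
rewrite RintegralD// big_cons IH2 mxE -RintegralZl//; exact: ig.
Qed.

(** Testing against the integral itself reduces this triangle inequality to the
    Cauchy-Schwarz inequality under the integral sign. *)
Lemma enorm_vint_le t g :
  (forall i, mu.-integrable `[0, t] (EFin \o (fun s => g s ord0 i))) ->
  mu.-integrable `[0, t] (EFin \o (fun s => enorm (g s))) ->
  enorm (vint t g) <= \int[mu]_(s in `[0, t]) enorm (g s).
Proof.
move=> ig ie; set v := vint t g.
have [v0|v0] := eqVneq (enorm v) 0.
  by rewrite v0; apply: Rintegral_ge0 => s _; exact: enorm_ge0.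
have pv : 0 < enorm v by rewrite lt0r v0 enorm_ge0.
rewrite -(ler_pM2l pv) -expr2 enorm_sqr.
have [i1 {1}->] := integrable_dot v ig.
rewrite -RintegralZl//; apply: le_Rintegral => //.
  rewrite (_ : _ \o _ = (fun s => (enorm v)%:E * (enorm (g s))%:E)%E)//.
  exact: integrableZl.
by move=> s _; exact: dot_le_enorm.
Qed.

End curves.

Section integral_equation.
Context {R : realType} {d : nat}.
Notation mu := (@lebesgue_measure R).
Variables (F : R -> 'rV[R]_d -> 'rV[R]_d) (L K : R).
Hypotheses (L0 : 0 <= L) (K0 : 0 <= K).
Hypothesis F_lip : forall t x x', enorm (F t x' - F t x) <= L * enorm (x' - x).
Hypothesis F_joint : forall t x t' x' i,
  F t' x' ord0 i - F t x ord0 i <= K * (enorm (x' - x) + `|t' - t|).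
Implicit Types (W X Y g : R -> 'rV[R]_d).

Definition integral_solution W X :=
  forall t, t \in `[0, 1] -> X t = vint t (fun s => F s (X s)) + W t.

Lemma continuous_field X : continuous_curve X ->
  continuous_curve (fun s => F s (X s)).
Proof.
move=> cX i s; apply/cvgrPdist_le => e e0.
pose r s' := K * (enorm (X s' - X s) + `|s' - s|).
have cr : r s' @[s' --> s] --> (0 : R).
  have -> : 0 = r s by rewrite /r !subrr enorm0 normr0 addr0 mulr0.
  apply: cvgM; first exact: cvg_cst.
  apply: cvgD.
    by apply: continuous_enorm; apply: continuous_curveB => // j s';
      exact: cvg_cst.
  by apply: cvg_norm; apply: cvgB; [exact: cvg_id|exact: cvg_cst].
move/cvgrPdist_le : cr => /(_ _ e0); apply: filterS => s'.
rewrite sub0r normrN => h; apply: le_trans (le_trans (ler_norm _) h).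
rewrite ler_norml; apply/andP; split.
  by rewrite lerNl opprB; exact: F_joint.
by apply: (le_trans (F_joint _ _ _ _ _)); rewrite /r -(enormN (X s - _)) opprB
  distrC.
Qed.

(** A Cameron-Martin path [W' - W] gives the contraction estimate, and [g = 0]
    the uniqueness of solutions. *)
Lemma stability W W' X X' g :
  continuous_curve X -> continuous_curve X' ->
  integral_solution W X -> integral_solution W' X' ->
  measurable_fun (`[(0:R), 1] : set (measurableTypeR R)) g ->
  (\int[mu]_(s in `[(0:R)%R, 1%R]) ((enorm (g s) ^+ 2)%:E) < +oo)%E ->
  (forall t : R, t \in `[0, 1] -> W' t - W t = vint t g) ->
  enorm (X' 1 - X 1) <=
  Num.sqrt (expR (2 * L) * \int[mu]_(s in `[0, 1]) expR (- (2 * L) * s)) *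
  Num.sqrt (\int[mu]_(s in `[0, 1]) (enorm (g s) ^+ 2)).
Proof.
move=> cX cX' sX sX' mg g2 gW.
have mgi i : measurable_fun `[(0:R), 1] (fun s => g s ord0 i).
  exact: (measurableT_comp (measurable_coord _ _) mg).
have mk : measurable_fun `[(0:R), 1] (fun s => enorm (g s)).
  apply: (measurableT_comp (continuous_measurable_fun (@sqrt_continuous R))).
  by apply: measurable_sum => i; exact: measurable_funX.
have ik2 : mu.-integrable `[0, 1] (EFin \o (fun s => enorm (g s) ^+ 2)).
  apply/integrableP; split; first by apply/measurable_EFinP;
    exact: measurable_funX.
  by under eq_integral do rewrite /= ger0_norm ?sqr_ge0//.
have i1 : mu.-integrable `[0, 1] (EFin \o (fun=> 1 : R)).
  by apply: continuous_integrable => s; exact: cvg_cst.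
have ik : mu.-integrable `[0, 1] (EFin \o (fun s => enorm (g s))).
  have i12 : mu.-integrable `[0, 1] (EFin \o (fun s => 1 + enorm (g s) ^+ 2)).
    exact: (integrableD _ i1 ik2).
  apply: (le_integrable _ _ _ i12) => //; first exact/measurable_EFinP.
  move=> s _; rewrite lee_fin !ger0_norm ?enorm_ge0 ?addr_ge0 ?sqr_ge0//.
  by have := sqr_ge0 (enorm (g s) - 1); have := enorm_ge0 (g s); nra.
have igi i : mu.-integrable `[0, 1] (EFin \o (fun s => g s ord0 i)).
  apply: (le_integrable _ _ _ ik) => //; first by apply/measurable_EFinP;
    exact: mgi.
  by move=> s _; rewrite lee_fin (ger0_norm (enorm_ge0 _)) normr_coord_le_enorm.
pose u s := enorm (X' s - X s).
have cu : continuous u by apply: continuous_enorm; exact: continuous_curveB.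
apply: (le_trans _ (exp_weight_l2 L0 ik ik2)).
apply: (integrable_gronwall (u := u) L0 cu ik) => t t01.
rewrite /u sX'// sX//.
have cF := continuous_field cX; have cF' := continuous_field cX'.
have iF i : mu.-integrable `[0, t] (EFin \o (fun s => F s (X s) ord0 i)).
  exact: continuous_integrable.
have iF' i : mu.-integrable `[0, t] (EFin \o (fun s => F s (X' s) ord0 i)).
  exact: continuous_integrable.
have igt i : mu.-integrable `[0, t] (EFin \o (fun s => g s ord0 i)).
  by apply: integrable_subsegment.
rewrite opprD addrACA gW// -vintB//.
set G := fun s => F s (X' s) - F s (X s).
have iG i : mu.-integrable `[0, t] (EFin \o (fun s => G s ord0 i)).
  by apply: continuous_integrable; exact: continuous_curveB.
have iGe : mu.-integrable `[0, t] (EFin \o (fun s => enorm (G s))).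
  by apply: continuous_integrable; apply: continuous_enorm;
    exact: continuous_curveB.
have ige : mu.-integrable `[0, t] (EFin \o (fun s => enorm (g s))).
  by apply: integrable_subsegment.
have iu : mu.-integrable `[0, t] (EFin \o (fun s => L * u s)).
  apply: continuous_integrable => s.
  by apply: cvgM; [exact: cvg_cst|exact: cu].
rewrite (le_trans (enormD _ _))// RintegralD// lerD//;
  last exact: enorm_vint_le.
apply: (le_trans (enorm_vint_le iG iGe)); apply: le_Rintegral => //.
by move=> s _; exact: F_lip.
Qed.

End integral_equation.

(** * Existence and measurability of solutions *)

Section caratheodory.
Context d (T : measurableType d) (R : realType).
Notation mu := (@lebesgue_measure R).
Variable phi : R -> T -> R.
Hypothesis cphi : forall w, continuous (phi ^~ w).
Hypothesis mphi : forall r, measurable_fun setT (phi r).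

Let grid (n : nat) (r : R) : R := (Num.floor (n.+1%:R * r))%:~R / n.+1%:R.

Let grid_cvg r : grid n r @[n --> \oo] --> r.
Proof.
apply/cvgrPdist_le => e e0.
near=> n.
have n0 : (0 : R) < n.+1%:R by rewrite ltr0n.
have := floor_itv (n.+1%:R * r) => /andP[f1 f2].
have ne : n.+1%:R^-1 < e.
  by near: n; exact: (near_infty_natSinv_lt (PosNum e0)).
rewrite /grid ger0_norm.
  rewrite (le_trans _ (ltW ne))// -(ler_pM2l n0) mulrBr mulfV ?gt_eqF//.
  rewrite mulrCA mulfV ?gt_eqF// mulr1 lerBlDl ltW//.
  by move: f2; rewrite intrD addrC.
by rewrite subr_ge0 ler_pdivrMr// [r * _]mulrC.
Unshelve. all: end_near. Qed.

Let measurable_grid n :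
  measurable_fun setT (fun p : measurableTypeR R * T => phi (grid n p.1) p.2).
Proof.
move=> _ B mB; rewrite setTI.
have n0 : (0 : R) < n.+1%:R by rewrite ltr0n.
rewrite (_ : _ @^-1` _ = \bigcup_(k : int)
  ([set` `[k%:~R / n.+1%:R, (k + 1)%:~R / n.+1%:R[%R] `*`
   (phi (k%:~R / n.+1%:R) @^-1` B))).
  apply: countable_bigcupT_measurable => [|k]; first exact: countableP.
  apply: measurableX => //.
  by rewrite -[X in measurable X]setTI; exact: mphi.
have gridE (k : int) (r : R) : r \in `[k%:~R / n.+1%:R, (k + 1)%:~R / n.+1%:R[
  ->
    Num.floor (n.+1%:R * r) = k.
  rewrite in_itv/= ler_pdivrMr// ltr_pdivlMr// ![r * _]mulrC => h.
  exact: floor_def.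
apply/seteqP; split => [[r w] /= Brw|[r w] [k _ [/= rk Bk]]].
  exists (Num.floor (n.+1%:R * r)) => //; split => //=.
  rewrite in_itv/= ler_pdivrMr// ltr_pdivlMr// ![r * _]mulrC.
  exact: floor_itv.
by rewrite /grid (gridE k).
Qed.

(** Freezing [r] on the cells of a grid gives a countable union of measurable
    rectangles; continuity in [r] allows the mesh to tend to 0. *)
Lemma caratheodory_measurable :
  measurable_fun setT (fun p : measurableTypeR R * T => phi p.1 p.2).
Proof.
apply: (measurable_fun_cvg (h := fun n p => phi (grid n p.1) p.2)).
  by move=> n; exact: measurable_grid.
move=> [r w] _ /=.
have := cvg_comp _ _ (@grid_cvg r) (@cphi w r); exact.
Qed.

(** Tonelli's theorem gives the measurability of integrals of nonnegative
    functions, hence the shift by the bound [M]. *)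
Lemma measurable_parameter_integral (M t : R) :
  (forall r w, `|phi r w| <= M) ->
  measurable_fun setT (fun w => \int[mu]_(r in `[0, t]) phi r w).
Proof.
move=> phiM.
pose g (p : measurableTypeR R * T) : \bar R :=
  ((\1_(`[0, t]%classic) p.1) * (phi p.1 p.2 + M))%:E.
have g0 p : (0 <= g p)%E.
  rewrite lee_fin mulr_ge0//.
  by have := phiM p.1 p.2; rewrite ler_norml => /andP[]; lra.
have mg : measurable_fun setT g.
  apply/measurable_EFinP; apply: measurable_funM.
    by apply: (measurableT_comp _ measurable_fst); exact: measurable_indic.
  by apply: measurable_funD => //; exact: caratheodory_measurable.
have mG : measurable_fun setT (fun w => \int[mu]_r g (r, w))%E.
  exact: (measurable_fun_fubini_tonelli_G g).
have iM : mu.-integrable `[0, t] (EFin \o (fun=> M : R)).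
  by apply: continuous_integrable => s; exact: cvg_cst.
have iphi w : mu.-integrable `[0, t] (EFin \o (phi ^~ w)).
  exact: continuous_integrable.
rewrite (_ : (fun _ => _) = (fun w => fine (\int[mu]_r g (r, w))%E
    - \int[mu]_(r in `[0, t]) M)).
  by apply: measurable_funB => //; exact: measurableT_comp mG.
apply/funext => w.
rewrite (_ : fine _ = \int[mu]_(r in `[0, t]) (phi r w + M)).
  by rewrite RintegralD// addrK.
rewrite /Rintegral [in RHS]integral_mkcond; congr fine;
  apply: eq_integral => r _.
by rewrite patchE /g indicE /=; case: ifP; rewrite ?mul1r ?mul0r.
Qed.

End caratheodory.

Section clamp.
Context {R : realType}.
Implicit Types b s t : R.

Definition clamp b s : R := Num.max 0 (Num.min s b).

Lemma clamp_itv b s : 0 <= b -> clamp b s \in `[0, b].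
Proof.
by move=> b0; rewrite /clamp in_itv/= le_max lexx /= ge_max b0 ge_min lexx orbT.
Qed.

Lemma clampK b s : s \in `[0, b] -> clamp b s = s.
Proof.
by rewrite /clamp in_itv/= => /andP[s0 sb]; rewrite (min_idPl sb) (max_idPr s0).
Qed.

Lemma clamp_lipschitz b s t : 0 <= b -> `|clamp b t - clamp b s| <= `|t - s|.
Proof.
move=> b0; have h1 := ler_norm (t - s); have h2 := ler_norm (s - t).
rewrite distrC in h2; rewrite /clamp.
have [s1|s1] := leP s b; have [t1|t1] := leP t b;
  have [s0|s0] := leP 0 s; have [t0|t0] := leP 0 t;
  rewrite ?(max_idPr b0) ler_norml; lra.
Qed.

Lemma lipschitz_continuous (f : R -> R) (M : R) :
  (forall s t, `|f t - f s| <= M * `|t - s|) -> continuous f.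
Proof.
move=> fM s; apply/cvgrPdist_le => e e0.
pose r t := M * `|s - t|.
have cr : r t @[t --> s] --> (0 : R).
  have -> : 0 = r s by rewrite /r subrr normr0 mulr0.
  apply: cvgM; first exact: cvg_cst.
  by apply: cvg_norm; apply: cvgB; [exact: cvg_cst|exact: cvg_id].
move/cvgrPdist_le : cr => /(_ _ e0); apply: filterS => t.
rewrite sub0r normrN => h; exact: le_trans (fM _ _) (le_trans (ler_norm _) h).
Qed.

Lemma continuous_clamp b : 0 <= b -> continuous (clamp b).
Proof.
move=> b0; apply: (lipschitz_continuous (M := 1)) => s t.
by rewrite mul1r; exact: clamp_lipschitz.
Qed.

End clamp.

Section geometric.
Context {R : realType}.

Lemma half_expn_cvg (C : R) : C * 2^-1 ^+ n @[n --> \oo] --> (0 : R).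
Proof.
rewrite -(mulr0 C); apply: cvgM; first exact: cvg_cst.
have := @cvg_geometric R 1 2^-1.
rewrite /geometric /=; under eq_fun do rewrite mul1r; apply.
by rewrite ger0_norm// invf_lt1// ltr1n.
Qed.

Lemma le_of_half_expn (x y C : R) : (forall n, x <= y + C * 2^-1 ^+ n) -> x <=
  y.
Proof.
move=> h; have cv : y + C * 2^-1 ^+ n @[n --> \oo] --> y + 0.
  by apply: cvgD; [exact: cvg_cst|exact: half_expn_cvg].
rewrite -(addr0 y) -(cvg_lim _ cv)//; apply: limr_ge; first exact: cvgP cv.
by near=> n; exact: h.
Unshelve. all: end_near. Qed.

Lemma half_expn_cauchy (a : R^nat) (C : R) :
  (forall n, `|a n.+1 - a n| <= C * 2^-1 ^+ n) ->
  forall n, `|lim (a @ \oo) - a n| <= 2 * C * 2^-1 ^+ n.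
Proof.
move=> h.
have C0 : 0 <= C by have := h 0%N; rewrite expr0 mulr1; exact: le_trans.
have ca : cvgn a.
  have cs : cvgn (series (telescope a)).
    apply: normed_cvg; apply: (@series_le_cvg _ _ (geometric C 2^-1)).
    - by move=> n; exact: normr_ge0.
    - by move=> n; rewrite /geometric /= mulr_ge0// exprn_ge0.
    - by move=> n; exact: h.
    - by apply: is_cvg_geometric_series; rewrite ger0_norm// invf_lt1// ltr1n.
  have -> : a = (fun n => a 0%N + series (telescope a) n).
    by apply/funext => n; exact: eq_sum_telescope.
  by apply: is_cvgD => //; exact: is_cvg_cst.
have dist n k : `|a (n + k)%N - a n| <= 2 * C * 2^-1 ^+ n - 2 * C * 2^-1 ^+ (n
  + k).
  elim: k => [|k IH]; first by rewrite addn0 !subrr normr0.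
  rewrite addnS; have := h (n + k)%N.
  have -> : a (n + k).+1 - a n = (a (n + k).+1 - a (n + k)%N) + (a (n + k)%N -
    a n).
    by ring.
  have := ler_normD (a (n + k).+1 - a (n + k)%N) (a (n + k)%N - a n).
  rewrite [2^-1 ^+ (n + k).+1]exprS; lra.
move=> n.
have cv : `|a m - a n| @[m --> \oo] --> `|lim (a @ \oo) - a n|.
  by apply: cvg_norm; apply: cvgB; [exact: ca|exact: cvg_cst].
rewrite -(cvg_lim _ cv)//; apply: limr_le; first exact: cvgP cv.
near=> m; have nm : (n <= m)%N by near: m; exact: nbhs_infty_ge.
rewrite -(subnKC nm) (le_trans (dist _ _))// lerBlDr lerDl.
by rewrite !mulr_ge0// exprn_ge0.
Unshelve. all: end_near. Qed.

End geometric.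

Section lipschitz_field.
Context {R : realType} {d : nat}.

Lemma enorm_lipschitz_measurable (f : 'rV[R]_d -> R) (K : R) : 0 <= K ->
  (forall x x', f x' - f x <= K * enorm (x' - x)) -> measurable_fun setT f.
Proof.
move=> K0 fK.
pose r (x x' : 'rV[R]_d) := K * \sum_(i < d) `|x ord0 i - x' ord0 i|.
have cr (x : 'rV[R]_d) : continuous (r x).
  have c1 : continuous (fun x' : 'rV[R]_d => \sum_(i < d) `|x ord0 i - x' ord0
    i|).
    apply: continuous_sum => i x'.
    apply: (continuous_comp (g := fun y : R => `|x ord0 i - y|)
      (f := fun x' : 'rV[R]_d => x' ord0 i)); first exact: coord_continuous.
    by apply: cvg_norm; apply: cvgB; [exact: cvg_cst|exact: cvg_id].
  move=> x'; apply: (continuous_comp (g := fun y : R => K * y) (c1 x')).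
  by apply: cvgM; [exact: cvg_cst|exact: cvg_id].
have rx x : r x x = 0.
  by rewrite /r big1 ?mulr0// => i _; rewrite subrr normr0.
have cf : continuous f.
  move=> x; apply/(@cvgrPdist_le _ _ _ (nbhs x) (nbhs_filter x)) => e e0.
  have crx : r x @ x --> (0 : R) by rewrite -(rx x); exact: cr.
  move: crx => /(@cvgrPdist_le _ _ _ (nbhs x) (nbhs_filter x)) /(_ _ e0);
    apply: filterS => x'.
  rewrite sub0r normrN => h; apply: le_trans (le_trans (ler_norm _) h).
  have le u : enorm (x - x') = u -> u <= \sum_(i < d) `|x ord0 i - x' ord0 i|.
    move=> <-; apply: (le_trans (enorm_le_sum _)).
    by apply: ler_sum => i _; rewrite !mxE.
  rewrite ler_norml; apply/andP; split.
    rewrite lerNl opprB (le_trans (fK _ _))// ler_wpM2l//.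
    by apply: le; rewrite -enormN opprB.
  by rewrite (le_trans (fK _ _))// ler_wpM2l//; exact: le.
apply: (measurability _ (RGenOpens.measurableE R)).
move=> _ [_ [a [b ->]] <-]; rewrite setTI; apply: open_measurable_mx.
by move/continuousP : cf; apply; exact: interval_open.
Qed.

End lipschitz_field.

Section picard.
Context {R : realType} {d : nat}.
Notation mu := (@lebesgue_measure R).
Variables (F : R -> 'rV[R]_d -> 'rV[R]_d) (L K M : R).
Hypotheses (L0 : 0 <= L) (K0 : 0 <= K).
Hypothesis F_lip : forall t x x', enorm (F t x' - F t x) <= L * enorm (x' - x).
Hypothesis F_joint : forall t x t' x' i,
  F t' x' ord0 i - F t x ord0 i <= K * (enorm (x' - x) + `|t' - t|).
Hypothesis F_bound : forall t x i, `|F t x ord0 i| <= M.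
Implicit Types (W X : R -> 'rV[R]_d).

Let cl := clamp (1 : R).

Let cl01 t : cl t \in `[0, 1]. Proof. exact: clamp_itv. Qed.

(** The iterates are frozen outside the unit interval, so that bounds and
    continuity hold on the whole line. *)
Fixpoint picard W n t : 'rV[R]_d :=
  if n is n'.+1 then vint (cl t) (fun s => F s (picard W n' s)) + W (cl t)
  else W (cl t).

Definition picard_lim W t : 'rV[R]_d :=
  \row_i lim (picard W n t ord0 i @[n --> \oo]).

Let cF := continuous_field F_joint.

Let field_integrable X i (t : R) : continuous_curve X ->
  mu.-integrable `[0, t] (EFin \o (fun s => F s (X s) ord0 i)).
Proof. by move=> cX; apply: continuous_integrable; exact: cF. Qed.

Let vint_lipschitz X i (s t : R) : continuous_curve X ->
  `|vint (cl t) (fun s => F s (X s)) ord0 i - vint (cl s) (fun s => F s (X s))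
    ord0 i|
  <= M * `|t - s|.
Proof.
move=> cX; rewrite !mxE.
have M0 : 0 <= M by apply: le_trans (normr_ge0 _) (F_bound 0 0 i).
wlog st : s t / cl s <= cl t.
  by move=> h; have [/h//|/ltW/h] := leP (cl s) (cl t);
    rewrite distrC [`|s - t|]distrC.
have := cl01 s; rewrite in_itv/= => /andP[s0 _].
apply: (le_trans (Rintegral_increment_le s0 st _ _)).
- exact: field_integrable.
- by move=> x _; exact: F_bound.
- rewrite ler_wpM2l// -[leLHS]ger0_norm ?subr_ge0//; exact: clamp_lipschitz.
Qed.

Variable W : R -> 'rV[R]_d.
Hypothesis cW : continuous_curve (W \o cl).

Lemma continuous_picard n : continuous_curve (picard W n).
Proof.
elim: n => [|n IH] //= i.
rewrite (_ : (fun _ => _) = (fun t => vint (cl t) (fun s => F s (picard W n s))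
  ord0 i
    + (W \o cl) t ord0 i)); last by apply/funext => t; rewrite !mxE.
move=> s; apply: cvgD; last exact: cW.
by apply: lipschitz_continuous => u v; exact: vint_lipschitz.
Qed.

(** A Lipschitz constant that is positive even when [L = 0]. *)
Let Lam := L + 1.
Let C := \sum_(i < d) M.

(** The exponential weight makes the Picard map contract by a factor 2 on the
    whole unit interval at once, whatever the Lipschitz constant. *)
Let picard_step n t : t \in `[0, 1] ->
  enorm (picard W n.+1 t - picard W n t) <=
  C * 2^-1 ^+ n * expR (2 * Lam * t).
Proof.
have M0 (i : 'I_d) : 0 <= M by apply: le_trans (normr_ge0 _) (F_bound 0 0 i).
have C0 : 0 <= C by apply: sumr_ge0 => i _; exact: M0 i.
have Lam0 : 0 < Lam by rewrite /Lam ltr_wpDl.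
elim: n t => [|n IH] t t01.
  have /andP[t0 t1] : (0 <= t <= 1) by move: t01; rewrite in_itv.
  rewrite /= addrK expr0 mulr1 /cl clampK//.
  apply: (@le_trans _ _ C); last first.
    rewrite ler_peMr// -expR0 ler_expR !mulr_ge0//; exact: ltW.
  apply: (le_trans (enorm_le_sum _)); apply: ler_sum => i _.
  have := @vint_lipschitz _ i 0 t (@continuous_picard 0).
  rewrite /cl !clampK ?in_itv/= ?lexx ?ler01 ?t0 ?t1//.
  rewrite [vint 0 _ _ _]mxE integral_segment0 !subr0 (ger0_norm t0) => h.
  by apply: (le_trans h); rewrite ler_piMr// (M0 i).
have ci X Y : continuous_curve X -> continuous_curve Y ->
    continuous (fun s => enorm (X s - Y s)).
  by move=> cX cY; apply: continuous_enorm; exact: continuous_curveB.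
have IH' s : s \in `[0, 1] -> enorm (picard W n.+1 s - picard W n s) <=
    C * 2^-1 ^+ n * expR (2 * Lam * s) := IH s.
have cY : continuous_curve (picard W n.+1) by exact: continuous_picard.
have cX : continuous_curve (picard W n) by exact: continuous_picard.
have E2 : picard W n.+2 t =
    vint (cl t) (fun s => F s (picard W n.+1 s)) + W (cl t) by [].
have E1 : picard W n.+1 t =
    vint (cl t) (fun s => F s (picard W n s)) + W (cl t) by [].
rewrite E2 E1 {E1 E2}; move: (picard W n.+1) (picard W n) IH' cY cX => Y X IH'
  cY cX.
rewrite opprD addrACA subrr addr0 /cl clampK// -vintB; last 2 first.
- by move=> i; exact: field_integrable.
- by move=> i; exact: field_integrable.
apply: (le_trans (enorm_vint_le _ _)).
- by move=> i; apply: continuous_integrable; apply: continuous_curveB;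
  exact: cF.
- by apply: continuous_integrable; apply: ci; exact: cF.
pose D := Lam * (C * 2^-1 ^+ n).
have D0 : 0 <= D by rewrite !mulr_ge0// ?(ltW Lam0)// exprn_ge0.
apply: (@le_trans _ _ (\int[mu]_(s in `[0, t]) (D * expR (2 * Lam * s)))).
  apply: le_Rintegral => //.
  - by apply: continuous_integrable; apply: ci; exact: cF.
  - by apply: continuous_integrable => s; apply: cvgM;
    [exact: cvg_cst|exact: continuous_expRM].
  move=> s /= st; have s01 : s \in `[0, 1].
    by move: st t01; rewrite !in_itv/= => /andP[-> st] /andP[_];
      exact: le_trans.
  apply: (le_trans (F_lip _ _ _)).
  rewrite /D -mulrA; apply: ler_pM; rewrite ?enorm_ge0//;
    first by rewrite /Lam lerDl.
  exact: IH'.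
rewrite RintegralZl//; last by apply: continuous_integrable;
  exact: continuous_expRM.
rewrite integral_expRM; last 2 first.
- by rewrite mulf_neq0// gt_eqF.
- by move: t01; rewrite in_itv/= => /andP[].
rewrite /D (_ : _ * _ = C * 2^-1 ^+ n.+1 * (expR (2 * Lam * t) - 1));
  last first.
  by rewrite exprS; field; rewrite gt_eqF.
rewrite ler_wpM2l//; first by rewrite mulr_ge0// exprn_ge0.
by rewrite lerBlDr lerDl.
Qed.

Let picard_clamp n t : picard W n t = picard W n (cl t).
Proof.
have clK : cl (cl t) = cl t by apply: clampK; exact: cl01.
by case: n => [|n] /=; rewrite clK.
Qed.

Let C' := 2 * (C * expR (2 * Lam)).

Let picard_lim_rate n t i :
  `|picard_lim W t ord0 i - picard W n t ord0 i| <= C' * 2^-1 ^+ n.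
Proof.
rewrite mxE; apply: half_expn_cauchy => {}n.
have -> : picard W n.+1 t ord0 i - picard W n t ord0 i =
    (picard W n.+1 t - picard W n t) ord0 i by rewrite !mxE.
apply: (le_trans (normr_coord_le_enorm _ _)).
rewrite (picard_clamp n.+1 t) (picard_clamp n t).
apply: (le_trans (picard_step _ (cl01 t))).
rewrite [leRHS]mulrAC ler_wpM2l//.
  rewrite mulr_ge0 ?exprn_ge0//; apply: sumr_ge0 => j _.
  exact: le_trans (normr_ge0 _) (F_bound 0 0 j).
rewrite ler_expR ler_piMr//; first by rewrite mulr_ge0// addr_ge0.
by have := cl01 t; rewrite in_itv/= => /andP[].
Qed.

Lemma picard_lim_cvg t i :
  picard W n t ord0 i @[n --> \oo] --> picard_lim W t ord0 i.
Proof.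
apply/cvgrPdist_le => e e0.
have := @half_expn_cvg R C' => /cvgrPdist_le /(_ _ e0); apply: filterS => n.
rewrite sub0r normrN => h.
exact: le_trans (picard_lim_rate n t i) (le_trans (ler_norm _) h).
Qed.

(** The iterates minus the driving path are uniformly Lipschitz, the field being
    bounded by [M], and this passes to the limit. *)
Lemma continuous_picard_lim : continuous_curve (picard_lim W).
Proof.
move=> i; pose g t := picard_lim W t ord0 i - W (cl t) ord0 i.
rewrite (_ : (fun _ => _) = (fun t => g t + (W \o cl) t ord0 i)); last first.
  by apply/funext => t; rewrite subrK.
suff cg : continuous g by move=> s; apply: cvgD; [exact: cg|exact: cW].
apply: (lipschitz_continuous (M := M)) => s t; rewrite /g.
apply: (@le_of_half_expn _ _ _ (2 * C')) => n.
have h1 := picard_lim_rate n.+1 t i; have h2 := picard_lim_rate n.+1 s i.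
have h3 := @vint_lipschitz _ i s t (@continuous_picard n).
move: h1 h2 h3; rewrite /= ![(_ + _ : 'rV_d) _ _]mxE.
set a := picard_lim W t _ _; set b := picard_lim W s _ _.
set p := vint _ _ _ _; set q := vint _ _ _ _.
have -> : C' * 2^-1 ^+ n.+1 = 2^-1 * (C' * 2^-1 ^+ n) by rewrite exprS; ring.
have -> : 2 * C' * 2^-1 ^+ n = 2 * (C' * 2^-1 ^+ n) by ring.
set wt := W (cl t) _ _; set ws := W (cl s) _ _ => h1 h2 h3.
have g1 := ler_normD (a - (p + wt)) ((p - q) + (q + ws - b)).
have g2 := ler_normD (p - q) (q + ws - b).
have g3 : `|q + ws - b| = `|b - (q + ws)| by exact: distrC.
have -> : a - wt - (b - ws) = a - (p + wt) + ((p - q) + (q + ws - b)) by ring.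
have := le_trans (normr_ge0 _) h1; lra.
Qed.

Lemma picard_lim_solution : integral_solution F W (picard_lim W).
Proof.
move=> t t01; apply/rowP => i.
have cX := continuous_picard_lim.
have clt : cl t = t by exact: clampK.
apply/eqP; rewrite -subr_eq0 -normr_le0.
pose D := K * \sum_(i < d) C' + C'.
apply: (@le_of_half_expn _ _ _ D) => n; rewrite add0r.
have h1 := picard_lim_rate n.+1 t i.
have C'0 : 0 <= C'.
  have := picard_lim_rate 0 t i; rewrite expr0 mulr1; exact: le_trans.
have q0 : 0 <= 2^-1 ^+ n :> R by rewrite exprn_ge0.
set e := vint t _.
have h2 : `|e ord0 i - vint t (fun s => F s (picard W n s)) ord0 i| <=
    K * (\sum_(i < d) C') * 2^-1 ^+ n.
  rewrite /e !mxE -RintegralB//; last 2 first.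
  - exact: field_integrable.
  - by apply: field_integrable; exact: continuous_picard.
  have ii : mu.-integrable `[0, t] (EFin \o
      (fun s => F s (picard_lim W s) ord0 i - F s (picard W n s) ord0 i)).
    apply: continuous_integrable => s; apply: cvgB; first exact: cF.
    by apply: (cF (@continuous_picard n)).
  apply: (le_trans (le_normr_Rintegral _ ii)) => //.
  set c := (leRHS).
  have c0 : 0 <= c by rewrite /c !mulr_ge0// sumr_ge0.
  apply: (@le_trans _ _ (\int[mu]_(s in `[0, t]) c)).
    apply: le_Rintegral => //.
    - exact: (integrable_norm ii).
    - by apply: continuous_integrable => s; exact: cvg_cst.
    move=> s _.
    have hs : enorm (picard_lim W s - picard W n s) <= (\sum_(i < d) C') * 2^-1
      ^+ n.
      apply: (le_trans (enorm_le_sum _)); rewrite mulr_suml;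
        apply: ler_sum => j _.
      by rewrite [(_ - _ : 'rV_d) _ _]mxE [(- _ : 'rV_d) _ _]mxE;
        exact: picard_lim_rate.
    have jl x x' : F s x' ord0 i - F s x ord0 i <= K * enorm (x' - x).
      by have := F_joint s x s x' i; rewrite subrr normr0 addr0.
    rewrite /c -mulrA ler_norml; apply/andP; split.
      rewrite lerNl opprB (le_trans (jl _ _))// ler_wpM2l//.
      by rewrite -enormN opprB.
    by rewrite (le_trans (jl _ _))// ler_wpM2l.
  rewrite Rintegral_cst//= lebesgue_measure_itv/= lte_fin.
  have /andP[t0 t1] : (0 <= t <= 1) by move: t01; rewrite in_itv.
  by case: ifP => _ /=; rewrite ?mulr0// subr0 ler_piMr.
move: h1 h2; rewrite /= clt ![(_ + _ : 'rV_d) _ _]mxE -/e.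
set a := picard_lim W t _ _; set p := vint _ _ _ _; set w := W t _ _.
have -> : D * 2^-1 ^+ n = K * (\sum_(i < d) C') * 2^-1 ^+ n + C' * 2^-1 ^+ n.
  by rewrite /D mulrDl.
have -> : C' * 2^-1 ^+ n.+1 = 2^-1 * (C' * 2^-1 ^+ n) by rewrite exprS; ring.
have := ler_normD (a - (p + w)) (p - e ord0 i).
rewrite (distrC p) => g1 h1 h2.
have -> : a - (e ord0 i + w) = a - (p + w) + (p - e ord0 i) by ring.
have := le_trans (normr_ge0 _) h1; lra.
Qed.

End picard.

Section measurable_picard.
Context {R : realType} {d : nat}.
Variables (F : R -> 'rV[R]_d -> 'rV[R]_d) (L K M : R).
Hypotheses (L0 : 0 <= L) (K0 : 0 <= K).
Hypothesis F_lip : forall t x x', enorm (F t x' - F t x) <= L * enorm (x' - x).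
Hypothesis F_joint : forall t x t' x' i,
  F t' x' ord0 i - F t x ord0 i <= K * (enorm (x' - x) + `|t' - t|).
Hypothesis F_bound : forall t x i, `|F t x ord0 i| <= M.

Context dT (T : measurableType dT).
Variables (t : R) (W : T -> R -> 'rV[R]_d).
Hypothesis t01 : t \in `[0, 1].
Hypothesis cW : forall w, continuous_curve (W w \o clamp 1).
Hypothesis mW : forall s i, s \in `[0, t] ->
  measurable_fun setT (fun w => W w s ord0 i).

Let t0 : 0 <= t. Proof. by move: t01; rewrite in_itv/= => /andP[]. Qed.

Let sub01 s : s \in `[0, t] -> s \in `[0, 1].
Proof.
by move: t01; rewrite !in_itv/= => /andP[_ t1] /andP[-> st];
  exact: le_trans st t1.
Qed.

Let mF r i : measurable_fun setT (fun x => F r x ord0 i).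
Proof.
apply: (enorm_lipschitz_measurable K0) => x x'.
by have := F_joint r x r x' i; rewrite subrr normr0 addr0.
Qed.

(** The iterates at time [s] only involve the path on [[0, s]]; the integrand is
    clamped to [[0, t]], where measurability is known. *)
Let measurable_picard n s i : s \in `[0, t] ->
  measurable_fun setT (fun w => picard F (W w) n s ord0 i).
Proof.
elim: n s i => [|n IH] s i st /=.
  by rewrite clampK ?sub01//; exact: mW.
rewrite clampK ?sub01//; under eq_fun do rewrite mxE.
apply: measurable_funD; last exact: mW.
pose phi r w := F (clamp t r) (picard F (W w) n (clamp t r)) ord0 i.
rewrite (_ : (fun _ => _) =
    (fun w => \int[lebesgue_measure]_(r in `[0, s]) phi r w)); last first.
  apply/funext => w; rewrite mxE; apply: eq_Rintegral => r.
  rewrite inE /= => rs; rewrite /phi clampK//.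
  move: rs st; rewrite !in_itv/= => /andP[-> rs] /andP[_]; exact: le_trans.
apply: (@measurable_parameter_integral _ T R phi _ _ M).
- move=> w r; apply: (continuous_comp (f := clamp t)
    (g := fun r => F r (picard F (W w) n r) ord0 i));
      first exact: continuous_clamp.
  apply: (continuous_field F_joint); exact: (continuous_picard F_joint F_bound).
- move=> r; apply: (measurableT_comp (mF (clamp t r) i)).
  apply: measurable_fun_mx => j k; rewrite ord1; apply: IH.
  exact: clamp_itv.
- by move=> r w; exact: F_bound.
Qed.

Lemma measurable_picard_lim : measurable_fun setT (fun w => picard_lim F (W w)
  t).
Proof.
apply: measurable_fun_mx => j k; rewrite ord1.
apply: (measurable_fun_cvg (h := fun n w => picard F (W w) n t ord0 k)).
  by move=> n; apply: measurable_picard; rewrite in_itv/= t0 lexx.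
by move=> w _; exact: (picard_lim_cvg L0 F_lip F_joint F_bound).
Qed.

End measurable_picard.

(** * The Brownian transport map *)

Section terminal_time.
Context {R : realType}.
Notation mu := (@lebesgue_measure R).

(** Lets the drift be arbitrary at the terminal time, where it is the gradient
    of the logarithm of an arbitrary version of the density. *)
Lemma integral_eq_before1 (f g : R -> R) (t : R) : t \in `[0, 1] ->
  (forall s, s < 1 -> f s = g s) ->
  mu.-integrable `[0, t] (EFin \o g) ->
  mu.-integrable `[0, t] (EFin \o f) /\
  \int[mu]_(s in `[0, t]) f s = \int[mu]_(s in `[0, t]) g s.
Proof.
rewrite in_itv/= => /andP[_ t1] fg ig.
have sub : `[0, t[ `<=` `[0, t] by apply: subset_itvl; rewrite bnd_simp.
have fgt s : s \in `[0, t[ -> f s = g s.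
  by rewrite in_itv/= => /andP[_ st]; apply: fg; exact: lt_le_trans st t1.
have mg : measurable_fun `[0, t[ g.
  have ig' : mu.-integrable `[0, t[ (EFin \o g) by exact: integrableS ig.
  by apply/measurable_EFinP; exact: measurable_int ig'.
have mf : measurable_fun `[0, t[ f.
  by apply: eq_measurable_fun mg => s; rewrite inE /= => st; rewrite fgt.
have mf' : measurable_fun `[0, t] f by exact/measurable_fun_itv_bndo_bndcP.
have [mg' g_lty] := (integrableP _ _ _ ig).
split.
  apply/integrableP; split; first exact/measurable_EFinP.
  rewrite -integral_itv_bndo_bndc; last first.
    by apply: measurableT_comp => //; exact/measurable_EFinP.
  move: g_lty; rewrite -integral_itv_bndo_bndc; last first.
    by apply: measurableT_comp => //; exact/measurable_EFinP.
  by under eq_integral => s /[!inE] st do rewrite /= -(fgt _ st).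
rewrite /Rintegral -2?integral_itv_bndo_bndc; [|exact/measurable_EFinP..].
by congr fine; apply: eq_integral => s; rewrite inE /= => st; rewrite fgt.
Qed.

End terminal_time.

Section curves_of_paths.
Context {R : realType} {d : nat}.

Lemma continuous_within_clamp (X : R -> 'rV[R]_d) :
  {within `[0, 1], continuous X} -> continuous_curve (X \o clamp 1).
Proof.
move=> /subspace_continuousP cX i s.
have c01 := @clamp_itv R 1 s ler01.
have cl : clamp 1 s' @[s' --> s] --> within `[0, 1] (nbhs (clamp 1 s)).
  move=> P hP.
  have h : nbhs s (fun s' => clamp 1 s' \in `[0, 1] -> P (clamp 1 s')).
    exact: (@continuous_clamp R 1 ler01 s _ hP).
  by apply: filterS h => s'; apply; exact: clamp_itv.
apply: (cvg_comp (X \o clamp 1) (fun x : 'rV[R]_d => x ord0 i)).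
  exact: (cvg_comp _ _ cl (cX _ c01)).
exact: coord_continuous.
Qed.

Lemma continuous_curve_mx (X : R -> 'rV[R]_d) : continuous_curve X ->
  continuous X.
Proof.
move=> cX s; apply/cvg_ballP => e e0.
have : \forall s' \near s, forall i, ball (X s ord0 i) e (X s' ord0 i).
  apply: (@filter_forall _ _ (fun i s' => ball (X s ord0 i) e (X s' ord0 i))
    (nbhs s) _) => i.
  by move/cvg_ballP : (cX i s); exact.
move=> H; near=> s'; have h : forall i, ball (X s ord0 i) e (X s' ord0 i).
  by near: s'.
by split => // i j; rewrite ord1; exact: h.
Unshelve. all: end_near. Qed.

End curves_of_paths.

Section brownian_transport.
Context {R : realType} {d : nat}.
Notation mu := (@lebesgue_measure R).
Notation Omega := (wiener_space R d).
Variables (gamma : probability Omega R) (nu : probability 'rV[R]_d R).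
Variable f : 'rV[R]_d -> R.
Hypothesis diam_lty : (diam (supp nu) < +oo)%E.
Hypothesis pf : is_density (convolution (gaussian d) nu) (gaussian d) f.

Let F := posterior_mean nu.
Let r := fine (diam (supp nu)).
Let L := r ^+ 2 / 4.

Let L0 : 0 <= L. Proof. by rewrite /L divr_ge0// sqr_ge0. Qed.

Let F_lip t x x' : enorm (F t x' - F t x) <= L * enorm (x' - x).
Proof. exact: posterior_mean_lipschitz. Qed.

(** The Follmer process solved path by path, without exceptional paths. *)
Definition follmer_flow (t : R) (w : Omega) : 'rV[R]_d := picard_lim F w t.

Let cw (w : Omega) : continuous_curve (w \o clamp 1).
Proof. by apply: continuous_within_clamp; exact: wpath_continuous. Qed.

Lemma continuous_follmer_flow (w : Omega) : continuous_curve (follmer_flow ^~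
  w).
Proof.
have [K K0 FK] := posterior_mean_joint_lipschitz diam_lty.
have [M FM] := posterior_mean_bounded diam_lty.
exact: (continuous_picard_lim L0 F_lip FK FM).
Qed.

Lemma follmer_flow_solution (w : Omega) :
  integral_solution F w (follmer_flow ^~ w).
Proof.
have [K K0 FK] := posterior_mean_joint_lipschitz diam_lty.
have [M FM] := posterior_mean_bounded diam_lty.
exact: (picard_lim_solution L0 K0 F_lip FK FM).
Qed.

Lemma measurable_follmer_flow dT (T : measurableType dT) (t : R) (W : T ->
  Omega) :
  t \in `[0, 1] ->
  (forall s i, s \in `[0, t] -> measurable_fun setT (fun w => W w s ord0 i)) ->
  measurable_fun setT (follmer_flow t \o W).
Proof.
move=> t01 mW.
have [K K0 FK] := posterior_mean_joint_lipschitz diam_lty.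
have [M FM] := posterior_mean_bounded diam_lty.
exact: (@measurable_picard_lim _ _ F L K M L0 K0 F_lip FK FM _ T t
  (fun x => wpath (W x)) t01 (fun x => @cw (W x)) mW).
Qed.

Let drift_integral (X : R -> 'rV[R]_d) t : t \in `[0, 1] -> continuous_curve X
  ->
  (forall i, mu.-integrable `[0, t]
     (EFin \o (fun s => follmer_drift f s (X s) ord0 i))) /\
  vint t (fun s => follmer_drift f s (X s)) = vint t (fun s => F s (X s)).
Proof.
move=> t01 cX.
have [K K0 FK] := posterior_mean_joint_lipschitz diam_lty.
have H i : mu.-integrable `[0, t] (EFin \o (fun s => F s (X s) ord0 i)).
  by apply: continuous_integrable; exact: (continuous_field FK).
have D i s : s < 1 -> follmer_drift f s (X s) ord0 i = F s (X s) ord0 i.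
  by move=> s1; rewrite (follmer_driftE diam_lty _ pf).
split=> [i|]; first exact: (integral_eq_before1 t01 (D i) (H i)).1.
by apply/rowP => i; rewrite !mxE; exact: (integral_eq_before1 t01 (D i) (H
  i)).2.
Qed.

Lemma follmer_flow_process : follmer_process gamma f follmer_flow.
Proof.
split=> [t B t01 mB|].
  exists (follmer_flow t @^-1` B); last first.
    by rewrite setYK; exact: negligible_set0.
  pose T := g_sigma_algebraType (@cylinder R d t).
  have mW (s : R) i : s \in `[0, t] -> measurable_fun setT (fun w : T => (w :
    Omega) s ord0 i).
    move=> st; apply: (measurableT_comp (measurable_coord _ _)).
    move=> _ C mC; rewrite setTI; apply: sub_sigma_algebra.
    by exists s, C.
  have := @measurable_follmer_flow _ T t id t01 mW measurableT B mB.
  by rewrite setTI.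
apply: aeW => w; have cX := @continuous_follmer_flow w.
split.
- by apply: continuous_subspaceT; exact: continuous_curve_mx.
- move=> i; have i01 : (1 : R) \in `[0, 1] by rewrite in_itv/= ler01 lexx.
  exact: (drift_integral i01 cX).1.
- by move=> t t01; rewrite (drift_integral t01 cX).2 follmer_flow_solution.
Qed.

(** Wherever [X] solves the integrated equation it coincides with the pathwise
    solution, by the stability estimate for a zero perturbation. *)
Lemma follmer_process_unique X : follmer_process gamma f X ->
  {ae gamma, forall w, follmer_flow 1 w = X 1 w}.
Proof.
move=> [_]; apply: filterS => w [cX _ sX].
have i01 : (1 : R) \in `[0, 1] by rewrite in_itv/= ler01 lexx.
pose Y := (X ^~ w) \o clamp 1.
have YE t : t \in `[0, 1] -> Y t = X t w by move=> t01; rewrite /Y /= clampK.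
have cY : continuous_curve Y by exact: continuous_within_clamp.
have [K K0 FK] := posterior_mean_joint_lipschitz diam_lty.
have sY : integral_solution F w Y.
  move=> t t01; rewrite (YE _ t01) (sX t t01); congr (_ + _).
  have [_ <-] := drift_integral t01 cY.
  apply/rowP => i; rewrite [LHS]mxE [RHS]mxE; apply: eq_Rintegral => s.
  move=> /set_mem st; suff -> : Y s = X s w by [].
  by apply: YE; move: st t01; rewrite /= !in_itv/= => /andP[-> st] /andP[_];
    exact: le_trans.
have := @stability _ _ F L K L0 F_lip FK w w Y (follmer_flow ^~ w) (fun=> 0)
  cY (@continuous_follmer_flow w) sY (follmer_flow_solution w).
have e0 : (fun _ : R => enorm (0 : 'rV[R]_d) ^+ 2) = (fun=> 0).
  by apply/funext => _; rewrite enorm0 expr0n.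
move=> /(_ (measurable_cst _)); rewrite enorm0 expr0n/=.
rewrite Rintegral_cst// mul0r sqrtr0 mulr0 integral0 ltry => /(_ isT) h.
have {h} : enorm (follmer_flow 1 w - Y 1) <= 0.
  by apply: h => t _; apply/rowP => i; rewrite subrr !mxE Rintegral_cst// mul0r.
rewrite YE// => h; apply/eqP; rewrite -subr_eq0; apply/eqP/enorm_eq0.
by apply/eqP; rewrite eq_le h enorm_ge0.
Qed.

Lemma follmer_flow_contraction :
  almost_sure_contraction gamma (follmer_flow 1) (contraction_constant r).
Proof.
apply: aeW => w h [g0 hg0].
have [mg g2 hE] : is_cm_derivative h (cm_derivative h) by exact: (xgetPex _
  (ex_intro _ g0 hg0)).
have [K K0 FK] := posterior_mean_joint_lipschitz diam_lty.
rewrite -contraction_constant_weight; last exact: diam_supp_ge0.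
apply: (stability L0 F_lip FK (W := w) (W' := wiener_add w h)) => //.
- exact: continuous_follmer_flow.
- exact: continuous_follmer_flow.
- exact: follmer_flow_solution.
- exact: follmer_flow_solution.
- by move=> t t01; rewrite /= addrC addKr hE.
Qed.

End brownian_transport.

Unset Implicit Arguments.

Theorem theorem1p3 (R : realType) (d : nat)
    (gamma : probability (wiener_space R d) R)
    (nu : probability 'rV[R]_d R) (f : 'rV[R]_d -> R) :
  wiener_measure gamma ->
  (diam (supp nu) < +oo)%E ->
  is_density (convolution (gaussian d) nu) (gaussian d) f ->
  (exists X : R -> wiener_space R d -> 'rV[R]_d, follmer_process gamma f X) /\
  (forall X : R -> wiener_space R d -> 'rV[R]_d, follmer_process gamma f X ->
    exists T : wiener_space R d -> 'rV[R]_d,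
      [/\ measurable_fun setT T,
          {ae gamma, forall w, T w = X 1 w}
        & almost_sure_contraction gamma T
            (contraction_constant (fine (diam (supp nu))))]).
Proof.
move=> _ diam_lty pf; split.
  by exists (follmer_flow nu); exact: follmer_flow_process.
move=> X hX; exists (follmer_flow nu 1); split.
- have i01 : (1 : R) \in `[0, 1] by rewrite in_itv/= ler01 lexx.
  apply: (measurable_follmer_flow diam_lty (W := id) i01) => s i s01.
  apply: (measurableT_comp (measurable_coord _ _)) => _ C mC; rewrite setTI.
  by apply: sub_sigma_algebra; exists s, C.
- exact: follmer_process_unique hX.
- exact: follmer_flow_contraction.
Qed.
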